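(* Let $G$ be an $n$-dimensional Lie group with Lie algebra $\mathfrak g$, equipped with the left-invariant metric induced by an inner product $(\cdot,\cdot)$ on $\mathfrak g$, let $q$ be the symmetric bilinear Euler–Arnold form on $\mathfrak g$, $Q(z,z')=q(z,z')$, let $\nu>0$, $\varepsilon>0$, and let $h=(h^{kl})$ be a constant symmetric positive semi-definite $n\times n$ matrix. Then the operator of the Fokker–Planck equation for $f=f(a,z;t)$, $(a,z)\in G\times\mathfrak g$, $$f_t+z^k e_k f+q^k(z,z)\frac{\partial f}{\partial z^k}+\frac{\partial}{\partial z^k}\left(-\nu z^k f-\frac{\varepsilon^2}{2}h^{kl}\frac{\partial f}{\partial z^l}\right)=0$$ satisfies the (parabolic) Hörmander condition if and only if $Q$ is non-degenerate with respect to the range of $h$ (considered as a map from $\mathfrak g$ to $\mathfrak g$).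
   Context: Summation over repeated indices is used. $e_1,\dots,e_n$ is an orthonormal basis of $\mathfrak g$ with respect to $(\cdot,\cdot)$; the same symbols denote the corresponding left-invariant vector fields on $G$, and $e_kf$ is the derivative of $f$ in the variable $a\in G$ along $e_k$. The tangent bundle $TG$ is identified with $G\times\mathfrak g$ by $(a,z)\mapsto z^ke_k(a)$, where $z^k$ are the coordinates of $z\in\mathfrak g$ in the basis $e_k$. Euler–Arnold form: $\tilde q:\mathfrak g\times\mathfrak g\to\mathfrak g$ is the bilinear map defined by $([x,y],z)=(\tilde q(z,x),y)$ for all $x,y,z\in\mathfrak g$, and $q(x,y)=\frac12(\tilde q(x,y)+\tilde q(y,x))$; $q^k$ denotes the $k$-th coordinate of $q$. Non-degeneracy: $Q$ is non-degenerate with respect to a set $\mathcal F\subset\mathfrak g$ if there is no linear subspace $M\subsetneq\mathfrak g$ containing $\mathcal F$ which is invariant under $Q$, in the sense that $Q(z,z')\in M$ whenever $z,z'\in M$. Parabolic Hörmander condition: write $h=\sigma\sigma^T$ with $\sigma$ a constant $n\times r$ matrix, and set $\mathcal X_j=\sum_k\sigma^k_j\frac{\partial}{\partial z^k}$ ($j=1,\dots,r$) and $\mathcal X_0=z^ke_k+(q^k(z,z)-\nu z^k)\frac{\partial}{\partial z^k}$, vector fields on $G\times\mathfrak g$. Let $\mathcal L$ be the smallest Lie algebra of vector fields on $G\times\mathfrak g$ which contains $\mathcal X_1,\dots,\mathcal X_r$ and is closed under $\mathcal X\mapsto[\mathcal X_0,\mathcal X]$. The operator satisfies the Hörmander condition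 if at every point $(a,z)\in G\times\mathfrak g$ the values of the vector fields in $\mathcal L$ span $T_{(a,z)}(G\times\mathfrak g)$. *)

(* Defs.v *)
From HB Require Import structures.
From mathcomp Require Import all_boot all_order all_algebra sesquilinear.
From mathcomp Require Import all_classical all_reals all_analysis.

Set Implicit Arguments.
Unset Strict Implicit.
Unset Printing Implicit Defensive.

Import Order.TTheory GRing.Theory Num.Theory.
Import numFieldNormedType.Exports.

Local Open Scope classical_set_scope.
Local Open Scope ring_scope.

Definition iter_partial (R : realType) (m : nat) (s : seq 'I_m)
    (f : 'rV[R]_m -> R) : 'rV[R]_m -> R :=
  foldr (fun (i : 'I_m) (g : 'rV[R]_m -> R) x => 'D_(delta_mx 0 i) g x) f s.

(* Only meant for open [D]: [f] is C^oo on [D] when all its iterated partial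
   derivatives exist and are continuous at every point of [D]. *)
Definition smooth_on (R : realType) (m : nat) (D : set 'rV[R]_m)
    (f : 'rV[R]_m -> R) : Prop :=
  forall (s : seq 'I_m) (x : 'rV[R]_m), D x ->
    {for x, continuous (iter_partial s f)} /\
    forall i : 'I_m, derivable (iter_partial s f) x (delta_mx 0 i).

Definition smooth_map_on (R : realType) (m p : nat) (D : set 'rV[R]_m)
    (f : 'rV[R]_m -> 'rV[R]_p) : Prop :=
  forall j : 'I_p, smooth_on D (fun x => f x 0 j).

(* [chart_map] is only meaningful on [chart_dom], [chart_inv] on
   [chart_codom]. *)
Record chart (R : realType) (m : nat) (T : Type) := Chart {
  chart_dom : set T;
  chart_map : T -> 'rV[R]_m;
  chart_inv : 'rV[R]_m -> T }.

Definition chart_codom (R : realType) (m : nat) (T : Type) (c : chart R m T) :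
  set 'rV[R]_m := chart_map c @` chart_dom c.

Definition is_chart (R : realType) (m : nat) (T : topologicalType)
    (c : chart R m T) : Prop :=
  [/\ open (chart_dom c), open (chart_codom c),
      forall x, chart_dom c x -> chart_inv c (chart_map c x) = x,
      {within chart_dom c, continuous (chart_map c)} &
      {within chart_codom c, continuous (chart_inv c)}].

Definition smooth_fun (R : realType) (m : nat) (T : Type)
    (A : set (chart R m T)) (f : T -> R) : Prop :=
  forall c, A c -> smooth_on (chart_codom c) (f \o chart_inv c).

Definition smooth_in_charts (R : realType) (m p : nat) (T U : Type)
    (A : set (chart R m T)) (B : set (chart R p U)) (f : T -> U) : Prop :=
  forall c d, A c -> B d ->
    smooth_map_on
      (chart_codom c `&` [set x | chart_dom d (f (chart_inv c x))])
      (chart_map d \o f \o chart_inv c).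

(* The last clause says that all changes of charts are smooth. *)
Definition is_smooth_atlas (R : realType) (m : nat) (T : topologicalType)
    (A : set (chart R m T)) : Prop :=
  [/\ forall c, A c -> is_chart c,
      forall x : T, exists2 c, A c & chart_dom c x &
      smooth_in_charts A A id].

Definition prod_chart (R : realType) (m p : nat) (T U : Type)
    (c : chart R m T) (d : chart R p U) : chart R (m + p) (T * U) :=
  {| chart_dom := chart_dom c `*` chart_dom d;
     chart_map := fun x => row_mx (chart_map c x.1) (chart_map d x.2);
     chart_inv := fun y => (chart_inv c (lsubmx y), chart_inv d (rsubmx y)) |}.

Definition prod_atlas (R : realType) (m p : nat) (T U : Type)
    (A : set (chart R m T)) (B : set (chart R p U)) :
  set (chart R (m + p) (T * U)) :=
  [set b | exists c d, [/\ A c, B d & b = prod_chart c d]].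

(* The global chart of a vector space given by the coordinates in the
   basis [e]. *)
Definition coord_chart (R : realType) (n : nat) (g : vectType R)
    (e : n.-tuple g) : chart R n g :=
  {| chart_dom := [set: g];
     chart_map := fun z => \row_k coord e k z;
     chart_inv := fun y => \sum_(k < n) y 0 k *: e`_k |}.

Definition line_chart (R : realType) : chart R 1 R :=
  {| chart_dom := [set: R];
     chart_map := fun t => \row_(_ < 1) t;
     chart_inv := fun y => y 0 0 |}.

(* Tangent vectors and vector fields act on functions; only their action on
   smooth functions is meaningful, and two of them are regarded as equal when
   they agree on smooth functions. *)
Definition operator (R : realType) (T : Type) := (T -> R) -> (T -> R).

(* [v] belongs to the tangent space at [p]: it is the directional derivative
   along some vector [w] in some chart around [p]. *)
Definition tangent_vector (R : realType) (m : nat) (T : Type)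
    (A : set (chart R m T)) (p : T) (v : (T -> R) -> R) : Prop :=
  exists (c : chart R m T) (w : 'rV[R]_m),
    [/\ A c, chart_dom c p &
        forall f, smooth_fun A f ->
          v f = 'D_w (f \o chart_inv c) (chart_map c p)].

Definition vector_field (R : realType) (m : nat) (T : Type)
    (A : set (chart R m T)) (X : operator R T) : Prop :=
  (forall p, tangent_vector A p (fun f => X f p)) /\
  (forall f, smooth_fun A f -> smooth_fun A (X f)).

Definition commutator (R : realType) (T : Type) (X Y : operator R T) :
  operator R T := fun f p => X (Y f) p - Y (X f) p.

Definition lie_subalgebra (R : realType) (T : Type) (S : set (operator R T)) :
    Prop :=
  [/\ S (fun _ _ => 0),
      forall (a : R) X Y, S X -> S Y -> S (fun f p => a * X f p + Y f p) &
      forall X Y, S X -> S Y -> S (commutator X Y)].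

HB.mixin Record isLieGroup (R : realType) (n : nat) G
    of Topological G & Group G := {
  lie_atlas : set (chart R n G);
  lie_hausdorff : hausdorff_space G;
  lie_second_countable : @second_countable G;
  lie_atlasP : is_smooth_atlas lie_atlas;
  lie_mul_continuous : continuous (fun ab : G * G => (ab.1 * ab.2)%g);
  lie_mul_smooth : smooth_in_charts (prod_atlas lie_atlas lie_atlas) lie_atlas
    (fun ab : G * G => (ab.1 * ab.2)%g);
  lie_inv_continuous : continuous (fun a : G => a^-1%g);
  lie_inv_smooth : smooth_in_charts lie_atlas lie_atlas (fun a : G => a^-1%g)
}.

#[short(type="lieGroupType")]
HB.structure Definition LieGroup (R : realType) (n : nat) :=
  {G of isLieGroup R n G & Topological G & Group G}.

Definition atlas (R : realType) (n : nat) (G : lieGroupType R n) :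
  set (chart R n G) := @lie_atlas R n G.
Arguments atlas {R n} G.

Definition left_invariant_field (R : realType) (n : nat)
    (G : lieGroupType R n) (X : operator R G) : Prop :=
  vector_field (atlas G) X /\
  forall (b : G) f, smooth_fun (atlas G) f ->
    forall a, X (fun c => f (b * c)%g) a = X f (b * a)%g.

(* [g] with the bracket [br] is the Lie algebra of [G]: [lv] is a linear
   bijection from [g] onto the left-invariant vector fields on [G], and it
   carries [br] to the commutator of vector fields. *)
Definition is_lie_algebra_of (R : realType) (n : nat) (G : lieGroupType R n)
    (g : vectType R) (lv : g -> operator R G) (br : g -> g -> g) : Prop :=
  [/\ forall x, left_invariant_field (lv x),
      forall (a : R) x y f, smooth_fun (atlas G) f ->
        forall p, lv (a *: x + y) f p = a * lv x f p + lv y f p,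
      forall x y, (forall f, smooth_fun (atlas G) f -> lv x f =1 lv y f) ->
        x = y,
      forall X, left_invariant_field X ->
        exists x, forall f, smooth_fun (atlas G) f -> X f =1 lv x f &
      forall x y f, smooth_fun (atlas G) f ->
        lv (br x y) f =1 commutator (lv x) (lv y) f].

Definition orthonormal_basis (R : realType) (n : nat) (g : vectType R)
    (ip : {dot g for idfun}) (e : n.-tuple g) : Prop :=
  basis_of fullv e /\ forall i j : 'I_n, ip e`_i e`_j = (i == j)%:R.

Definition sym_form (R : realType) (g : vectType R) (qt : g -> g -> g)
    (x y : g) : g := 2^-1 *: (qt x y + qt y x).

Definition symmetric_psd (R : realType) (n : nat) (h : 'M[R]_n) : Prop :=
  h^T = h /\ forall x : 'cV[R]_n, 0 <= (x^T *m h *m x) 0 0.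

Definition mx_endo (R : realType) (n : nat) (g : vectType R) (e : n.-tuple g)
    (h : 'M[R]_n) (z : g) : g :=
  \sum_(k < n) (\sum_(l < n) h k l * coord e l z) *: e`_k.

Definition nondegenerate_wrt (R : realType) (g : vectType R) (Q : g -> g -> g)
    (F : set g) : Prop :=
  ~ exists M : {vspace g},
      [/\ M != fullv, forall z, F z -> z \in M &
          forall z z', z \in M -> z' \in M -> Q z z' \in M].

(* The smooth structure of [G * g] does not depend on the basis [e]. *)
Definition phase_atlas (R : realType) (n : nat) (G : lieGroupType R n)
    (g : vectType R) (e : n.-tuple g) : set (chart R (n + n) (G * g)) :=
  prod_atlas (atlas G) [set coord_chart e].
Arguments phase_atlas {R n} G {g} e.

Definition time_atlas (R : realType) (m : nat) (T : Type)
    (A : set (chart R m T)) : set (chart R (1 + m) (R * T)) :=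
  prod_atlas [set line_chart R] A.

Definition base_field (R : realType) (G : Type) (g : vectType R)
    (lv : g -> operator R G) (x : g) : operator R (G * g) :=
  fun F p => lv x (fun a => F (a, p.2)) p.1.

Definition fiber_field (R : realType) (G : Type) (g : vectType R) (x : g) :
  operator R (G * g) :=
  fun F p => derive1 (fun s : R => F (p.1, p.2 + s *: x)) 0.

Definition time_derivative (R : realType) (T : Type) : operator R (R * T) :=
  fun f tp => derive1 (fun s : R => f (s, tp.2)) tp.1.

Definition fokker_planck (R : realType) (n : nat) (G : lieGroupType R n)
    (g : vectType R) (lv : g -> operator R G) (e : n.-tuple g)
    (q : g -> g -> g) (nu eps : R) (h : 'M[R]_n) : operator R (R * (G * g)) :=
  fun f tp =>
    let F : G * g -> R := fun p => f (tp.1, p) in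
    let p := tp.2 in
    time_derivative f tp
    + \sum_(k < n) coord e k p.2 * base_field lv e`_k F p
    + \sum_(k < n) coord e k (q p.2 p.2) * fiber_field e`_k F p
    + \sum_(k < n) fiber_field e`_k
        (fun p' => - (nu * coord e k p'.2 * F p')
                   - eps ^+ 2 / 2 * \sum_(l < n) h k l * fiber_field e`_l F p')
        p.

Definition drift_field (R : realType) (n : nat) (G : lieGroupType R n)
    (g : vectType R) (lv : g -> operator R G) (e : n.-tuple g)
    (q : g -> g -> g) (nu : R) : operator R (G * g) :=
  fun F p =>
    \sum_(k < n) coord e k p.2 * base_field lv e`_k F p
    + \sum_(k < n) (coord e k (q p.2 p.2) - nu * coord e k p.2)
                   * fiber_field e`_k F p.

Definition diffusion_field (R : realType) (n r : nat) (G : lieGroupType R n)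
    (g : vectType R) (e : n.-tuple g) (sigma : 'M[R]_(n, r)) (j : 'I_r) :
  operator R (G * g) :=
  fun F p => \sum_(k < n) sigma k j * fiber_field e`_k F p.
Arguments diffusion_field {R n r} G {g} e sigma j.

(* [P = d/dt + X0 - kappa * sum_j X_j^2 + c] with constants [kappa > 0], [c]. *)
Definition sum_of_squares_form (R : realType) (m r : nat) (T : Type)
    (A : set (chart R m T)) (P : operator R (R * T)) (X0 : operator R T)
    (X : 'I_r -> operator R T) : Prop :=
  exists kappa c : R, 0 < kappa /\
    forall f, smooth_fun (time_atlas A) f -> forall tp,
      let F := fun p => f (tp.1, p) in
      P f tp = time_derivative f tp + X0 F tp.2
               - kappa * (\sum_(j < r) X j (X j F) tp.2) + c * F tp.2.

Definition hormander_algebra (R : realType) (r : nat) (T : Type)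
    (X0 : operator R T) (X : 'I_r -> operator R T) : set (operator R T) :=
  smallest
    (fun S => lie_subalgebra S /\ forall Y, S Y -> S (commutator X0 Y))
    (range X).

(* The first clause ties the fields to the operator [P]; the second is the
   bracket condition.  As [hormander_algebra] is a linear space of vector fields,
   the set of their values at [p] is its own span. *)
Definition hormander_condition (R : realType) (m r : nat) (T : Type)
    (A : set (chart R m T)) (P : operator R (R * T)) (X0 : operator R T)
    (X : 'I_r -> operator R T) : Prop :=
  sum_of_squares_form A P X0 X /\
  forall (p : T) (v : (T -> R) -> R), tangent_vector A p v ->
    exists2 Y, hormander_algebra X0 X Y &
      forall F, smooth_fun A F -> v F = Y F p.

(* Main.v *)
Require Import Defs.
From HB Require Import structures.
From mathcomp Require Import all_boot all_order all_algebra sesquilinear.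
From mathcomp Require Import all_classical all_reals all_analysis.
From mathcomp Require Import ring.

(** Write [X0] for the drift, [d_v] for the vertical field with constant direction
    [v] and [v^] for the left-invariant field of [v], acting on the group variable.

    The theorem rests on two brackets.  As [v^] and [d_w] commute, and as the
    vertical part of [X0] is quadratic in [z],
    [[
      [X0, d_v] = - v^ - d_(2 q(z, v) - nu v)       (fiber_drift)
      [[X0, d_v], d_w] = d_(2 q(v, w))              (bracket_fiber)
    ]]
    Suppose that [q] is non-degenerate.  By the second formula, the directions [v]
    for which the algebra contains [d_v] form a subspace that is stable under [q].
    It contains the columns of [sigma], which span the range of [sigma sigma^T]
    (range_gram), so it is the whole Lie algebra (vertical_directions).  The first
    formula then yields [v^] up to a vertical vector, and the left-invariant fields
    span the tangent spaces of the group (left_invariant_span): all tangent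
    vectors are reached (nondegenerate_spans).

    Conversely, let a subspace [M] be stable under [q] and contain the columns of
    [sigma].  Then [X0] and the diffusion fields are tangent to [G * M], hence so
    is the whole algebra (hormander_tangent), and no vertical direction outside
    [M] is reached at the points of [G * M] (spans_nondegenerate).

    Vector fields being operators on functions, the brackets make sense because
    [X0] preserves smoothness.  For a left-invariant field this has to hold jointly
    in [a] and [z], so one needs its coefficients in a chart.  Instead of using
    cut-off functions, they are read off from left invariance: the identity
    [X f (a) = X (f (a * _)) (1)] exhibits them as partial derivatives of the
    multiplication map (left_invariant_chart).

    This requires the following calculus in finitely many variables: continuous
    partial derivatives imply differentiability (differentiable_C1), partial
    derivatives commute (partial_commute), and composites of smooth maps are smooth
    (smooth_on_comp). *)

Set Implicit Arguments.
Unset Strict Implicit.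
Unset Printing Implicit Defensive.

Import Order.TTheory GRing.Theory Num.Theory.
Import numFieldNormedType.Exports.

Local Open Scope classical_set_scope.
Local Open Scope ring_scope.

(** * Differentiability from partial derivatives *)

Lemma is_derive_line (R : realType) (V : normedModType R) (f : V -> R)
    (y v : V) (t : R) : derivable f (y + t *: v) v ->
  is_derive t 1 (fun s => f (y + s *: v)) ('D_v f (y + t *: v)).
Proof.
have E : (fun h : R => h^-1 *: (((fun s => f (y + s *: v)) \o shift t) (h *: 1)
            - f (y + t *: v)))
  = (fun h => h^-1 *: ((f \o shift (y + t *: v)) (h *: v) - f (y + t *: v))).
  apply/funext => h /=; do 3 congr (_ _).
  by rewrite [h *: 1]mulr1 scalerDl addrCA.
by move=> df; split; rewrite /derivable /derive E.
Qed.

(** Allowing both signs of [b] is what makes this usable for the increments of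
    the coordinates of an arbitrary vector. *)
Lemma MVT0 (R : realType) (g : R -> R) (b : R) :
  (forall t, `|t| <= `|b| -> derivable g t 1) ->
  exists2 c, `|c| <= `|b| & g b - g 0 = 'D_1 g c * b.
Proof.
move=> dg.
have [b0|b0] := leP 0 b.
  have inb (t : R) : t \in `[0, b] -> `|t| <= `|b|.
    by rewrite in_itv /= => /andP[t0 tb]; rewrite !ger0_norm.
  have [||c cb ->] := @MVT_segment R g ('D_1 g) 0 b b0.
  - move=> t tb; apply/derivableP/dg/inb.
    by move: tb; rewrite !in_itv /= => /andP[/ltW -> /ltW ->].
  - by apply: derivable_within_continuous => t /inb /dg.
  by exists c; [exact: inb | rewrite subr0].
have inb (t : R) : t \in `[b, 0] -> `|t| <= `|b|.
  rewrite in_itv /= => /andP[bt t0].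
  by rewrite !ler0_norm ?(ltW b0)// lerN2.
have [||c cb E] := @MVT_segment R g ('D_1 g) b 0 (ltW b0).
- move=> t tb; apply/derivableP/dg/inb.
  by move: tb; rewrite !in_itv /= => /andP[/ltW -> /ltW ->].
- by apply: derivable_within_continuous => t /inb /dg.
exists c; first exact: inb.
by rewrite -opprB E sub0r mulrN opprK.
Qed.

Lemma differentiable_linear_approx (R : numFieldType) (V W : normedModType R)
    (f : V -> W) (x : V) (df : {linear V -> W}) : continuous df ->
  (forall e, 0 < e -> \forall h \near (0 : V),
     `|f (h + x) - f x - df h| <= e * `|h|) ->
  differentiable f x.
Proof.
move=> dc H; have fo : f \o shift x = cst (f x) + df +o_ 0 id.
  apply/eqaddoP => e e0; have := H _ e0; apply: filterS => h.
  by rewrite -addrA -opprD.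
by apply/diff_locallyP; rewrite (diff_unique dc fo).
Qed.

Section linear_approximation.
Context (R : realType) (m : nat).
Implicit Types (f : 'rV[R]_m -> R) (x h v : 'rV[R]_m).

Lemma differentiable_approx f x (p : 'I_m -> R) :
  (forall e, 0 < e -> \forall h \near (0 : 'rV[R]_m),
     `|f (h + x) - f x - \sum_i h 0 i * p i| <= e * `|h|) ->
  differentiable f x.
Proof.
move=> H.
pose d h : R := \sum_i h 0 i * p i.
have dlin : linear d.
  move=> a u v; rewrite /d scaler_sumr -big_split /=; apply: eq_bigr => i _.
  by rewrite !mxE mulrDl [in RHS]/GRing.scale /= mulrA.
pose dM := GRing.isLinear.Build _ _ _ _ _ dlin.
pose dL : {linear 'rV[R]_m -> R} := HB.pack d dM.
have dc : continuous dL.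
  move=> y; apply: differentiable_continuous.
  rewrite (_ : (dL : _ -> _) = (\sum_(i < m) (fun u : 'rV[R]_m => u 0 i * p i))).
    apply: differentiable_sum => i.
    apply: differentiableM; last exact: differentiable_cst.
    exact: differentiable_coord.
  by apply/funext => u; rewrite fct_sumE.
exact: (@differentiable_linear_approx _ _ _ _ _ dL).
Qed.

Lemma norm_coord_le h i : `|h 0 i| <= `|h|.
Proof.
rewrite [leRHS]/Num.Def.normr /= mx_normrE.
exact: (le_bigmax _ (fun ij : 'I_1 * 'I_m => `|h ij.1 ij.2|) (0, i)).
Qed.

Lemma norm_row_le h (e : R) : 0 <= e -> (forall i, `|h 0 i| <= e) -> `|h| <= e.
Proof.
move=> e0 he; rewrite [leLHS]/Num.Def.normr /= mx_normrE (bigmax_le _ e0)//=.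
by move=> -[j i] _ /=; rewrite ord1.
Qed.

(** Coordinatewise mean value theorem along the broken line that switches the
    coordinates of [h] on one after the other; the norm of ['rV_m] is the
    maximum norm, so that the broken line stays in the ball of radius [`|h|]. *)
Lemma differentiable_C1 f x :
  (\forall y \near x, forall i, derivable f y (delta_mx 0 i)) ->
  (forall i, {for x, continuous ('D_(delta_mx 0 i) f)}) ->
  differentiable f x.
Proof.
move=> df cf.
apply: (@differentiable_approx _ _ (fun i => 'D_(delta_mx 0 i) f x)) => e e0.
have e'0 : 0 < e / m.+1%:R by rewrite divr_gt0.
have cf' i : \forall y \near x,
    `|'D_(delta_mx 0 i) f y - 'D_(delta_mx 0 i) f x| <= e / m.+1%:R.
  have /cvgrPdist_le/(_ _ e'0) := cf i.
  by apply: filterS => y; rewrite distrC.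
have /nbhs_ballP[d /= d0 Hd] : \forall y \near x,
    (forall i, derivable f y (delta_mx 0 i)) /\
    (forall i, `|'D_(delta_mx 0 i) f y - 'D_(delta_mx 0 i) f x| <= e / m.+1%:R).
  by apply: filterI => //; exact: (filter_forall (nbhs_filter x) cf').
apply/nbhs_norm0P; exists d => // h /= hd.
have inball y : `|y| <= `|h| -> ball x d (y + x).
  by move=> yh; rewrite -ball_normE /= opprD addrC subrK normrN (le_lt_trans yh).
pose tr k : 'rV[R]_m := \row_i (if (i < k)%N then h 0 i else 0).
have -> : f (h + x) - f x = \sum_(k < m) (f (tr k.+1 + x) - f (tr k + x)).
  rewrite -(big_mkord xpredT (fun k => f (tr k.+1 + x) - f (tr k + x))).
  rewrite telescope_sumr//; congr (f _ - f _).
    by congr (_ + _); apply/rowP => i; rewrite mxE ltn_ord.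
  by rewrite -[LHS]add0r; congr (_ + _); apply/rowP => i; rewrite !mxE.
rewrite -sumrB.
have step (k : 'I_m) : `|f (tr k.+1 + x) - f (tr k + x)
    - h 0 k * 'D_(delta_mx 0 k) f x| <= e / m.+1%:R * `|h|.
  pose l t := tr k + x + t *: delta_mx 0 k.
  have lin t : `|t| <= `|h 0 k| -> ball x d (l t).
    move=> tk; rewrite /l addrAC; apply: inball.
    apply: norm_row_le => // i; rewrite !mxE eqxx /=.
    have [->|ik] := eqVneq i k.
      by rewrite ltnn add0r mulr1 (le_trans tk)// norm_coord_le.
    rewrite mulr0 addr0; case: ifP => _; last by rewrite normr0.
    exact: norm_coord_le.
  have dl (t : R) : `|t| <= `|h 0 k| ->
      is_derive t (1 : R) (fun s : R => f (l s)) ('D_(delta_mx 0 k) f (l t)).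
    by move=> tk; apply: is_derive_line; have [+ _] := Hd _ (lin _ tk); apply.
  have [|c ck] := @MVT0 R (fun s => f (l s)) (h 0 k).
    by move=> t /dl [].
  have -> : l (h 0 k) = tr k.+1 + x.
    rewrite /l addrAC; congr (_ + _); apply/rowP => i; rewrite !mxE eqxx /=.
    rewrite ltnS -[(i == k)]/(nat_of_ord i == nat_of_ord k).
    have [ik|ik] := eqVneq (nat_of_ord i) k.
      by rewrite (ord_inj ik) ltnn leqnn add0r mulr1.
    by rewrite mulr0 addr0 ltn_neqAle ik.
  rewrite /l scale0r addr0 => ->; have [_ ->] := dl _ ck.
  rewrite mulrC -mulrBr normrM mulrC; apply: ler_pM => //.
    by have [_ +] := Hd _ (lin _ ck); apply.
  exact: norm_coord_le.
apply: (le_trans (ler_norm_sum _ _ _)).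
apply: (le_trans (ler_sum _ (fun k _ => step k))).
rewrite sumr_const card_ord -mulrnAl ler_wpM2r//.
rewrite -mulr_natl mulrCA ler_piMr// ?(ltW e0)//.
by rewrite ler_pdivrMr// mul1r ler_nat.
Qed.

End linear_approximation.

(** * Functions of class C^k *)

Section derivative_lemmas.
Context (R : realType).
Implicit Types V W : normedModType R.

Lemma derive_lineE V W (f : V -> W) (x v : V) :
  'D_v f x = 'D_1 (fun h : R => f (h *: v + x)) 0.
Proof.
rewrite /derive; set g1 := fun h => h^-1 *: _; set g2 := fun h => h^-1 *: _.
suff -> : g1 = g2 by []; apply/funext => h; rewrite /g1 /g2 /=.
by rewrite addr0 scale0r add0r [_%:A]mulr1.
Qed.

Lemma derivable_rowP m V (phi : V -> 'rV[R]_m) (x v : V) :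
  derivable phi x v <-> forall j, derivable (fun y => phi y 0 j) x v.
Proof.
split=> [/derivable_mxP + j|H]; first exact.
by apply/derivable_mxP => i j; rewrite ord1.
Qed.

Lemma derive_rowE m V (phi : V -> 'rV[R]_m) (x v : V) j :
  derivable phi x v -> 'D_v phi x 0 j = 'D_v (fun y => phi y 0 j) x.
Proof. by move=> dphi; rewrite derive_mx// mxE. Qed.

(** Along the line through [x] of direction [v], [phi] is a derivable curve, hence
    a differentiable one, to which the chain rule of differentials applies. *)
Lemma is_derive_chain V W (U : normedModType R) (phi : V -> W) (f : W -> U)
    (x v : V) : derivable phi x v -> differentiable f (phi x) ->
  is_derive x v (f \o phi) ('D_('D_v phi x) f (phi x)).
Proof.
move=> dphi df.
pose g h := phi (h *: v + x).
have g0 : g 0 = phi x by rewrite /g scale0r add0r.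
have dg : differentiable g 0 by apply/derivable1_diffP; move/derivable1P: dphi.
have dfg : differentiable f (g 0) by rewrite g0.
have dc : differentiable (f \o g) 0 by exact: differentiable_comp.
split; first by apply/derivable1P/derivable1_diffP; exact: dc.
by rewrite derive_lineE (deriveE _ dc) diff_comp//= -!deriveE// -derive_lineE g0.
Qed.

Lemma derive_lin m (f : 'rV[R]_m -> R) (x w : 'rV[R]_m) :
  differentiable f x -> 'D_w f x = \sum_i w 0 i * 'D_(delta_mx 0 i) f x.
Proof.
move=> df; rewrite deriveE// {1}(row_sum_delta w) linear_sum.
by apply: eq_bigr => i _; rewrite linearZ deriveE.
Qed.

Lemma continuous_row m (T : topologicalType) (phi : T -> 'rV[R]_m) (x : T) :
  (forall j, {for x, continuous (fun y => phi y 0 j)}) ->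
  {for x, continuous phi}.
Proof.
move=> H; apply/cvgrPdist_le => e e0.
have H' j : \forall y \near x, `|phi x 0 j - phi y 0 j| <= e.
  by have /cvgrPdist_le := H j; apply.
apply: filterS (filter_forall (nbhs_filter x) H') => y Hy.
by apply: norm_row_le => [|i]; rewrite ?(ltW e0)// !mxE.
Qed.

End derivative_lemmas.

(** [smooth_on] quantifies over lists of partial derivatives, whereas sums,
    products and composites are handled by induction on the order of
    differentiability; [smooth_onP] relates the two. *)
Fixpoint Ck (R : realType) (m : nat) (D : set 'rV[R]_m) (k : nat)
    (f : 'rV[R]_m -> R) : Prop :=
  (forall x, D x -> {for x, continuous f}) /\
  if k is k'.+1 then
    forall i : 'I_m, (forall x, D x -> derivable f x (delta_mx 0 i)) /\
      Ck D k' ('D_(delta_mx 0 i) f)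
  else True.

Section Ck_theory.
Context (R : realType) (m : nat) (D : set 'rV[R]_m).
Implicit Types (f g : 'rV[R]_m -> R) (k : nat).

Lemma Ck_continuous k f x : Ck D k f -> D x -> {for x, continuous f}.
Proof. by case: k => [|k] [+ _]; apply. Qed.

Lemma smooth_on_partial f i : smooth_on D f -> smooth_on D ('D_(delta_mx 0 i) f).
Proof.
move=> sf s x Dx; have := sf (rcons s i) x Dx.
by rewrite /iter_partial foldr_rcons.
Qed.

Lemma smooth_onP f : smooth_on D f <-> forall k, Ck D k f.
Proof.
split=> [sf k|H s].
  elim: k f sf => [|k IH] f sf; split=> //.
  - by move=> x Dx; have [] := sf [::] x Dx.
  - by move=> x Dx; have [] := sf [::] x Dx.
  - move=> i; split; last exact/IH/smooth_on_partial.
    by move=> x Dx; have [_ +] := sf [::] x Dx; apply.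
elim/last_ind: s f H => [|s i IH] f H x Dx.
  split; first exact: (Ck_continuous (H 0%N)).
  by move=> i; have [_ /(_ i)[+ _]] := H 1%N; apply.
have -> : iter_partial (rcons s i) f = iter_partial s ('D_(delta_mx 0 i) f).
  by rewrite /iter_partial foldr_rcons.
by apply: IH => // k; have [_ /(_ i)[_]] := H k.+1.
Qed.

Lemma CkS k f : Ck D k.+1 f -> Ck D k f.
Proof.
elim: k f => [|k IH] f [cf H]; split => // i.
by have [dfi Hi] := H i; split => //; exact: IH.
Qed.

Lemma Ck_cst k (a : R) : Ck D k (cst a).
Proof.
elim: k a => [|k IH] a; split=> //; try by move=> x _; exact: cst_continuous.
move=> i; split=> [x _|]; first exact: derivable_cst.
have -> : 'D_(delta_mx 0 i) (cst a) = cst 0 :> ('rV[R]_m -> R); last exact: IH.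
by apply/funext => x; rewrite derive_cst.
Qed.

Lemma Ck_coord k (j : 'I_m) : Ck D k (fun x => x 0 j).
Proof.
have dc (x : 'rV[R]_m) : differentiable (fun y : 'rV[R]_m => y 0 j : R) x.
  exact: differentiable_coord.
case: k => [|k]; split=> //; try by move=> x _; exact: coord_continuous.
move=> i; split=> [x _|]; first exact: diff_derivable.
have -> : 'D_(delta_mx 0 i) (fun y : 'rV[R]_m => y 0 j) =
    cst ((delta_mx 0 i : 'rV[R]_m) 0 j) :> ('rV[R]_m -> R).
  apply/funext => x.
  have dx : derivable (id : 'rV[R]_m -> 'rV[R]_m) x (delta_mx 0 i).
    exact: derivable_id.
  by rewrite -(derive_rowE j dx) derive_id.
exact: Ck_cst.
Qed.

Context (oD : open D).

Lemma near_open x : D x -> \forall y \near x, D y.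
Proof. by move=> Dx; apply: open_nbhs_nbhs. Qed.

Lemma Ck_congr k f g : (forall x, D x -> f x = g x) -> Ck D k f -> Ck D k g.
Proof.
have near_fg x f1 g1 : (forall x, D x -> f1 x = g1 x) -> D x ->
    \forall y \near x, f1 y = g1 y.
  by move=> fg Dx; apply: filterS (near_open Dx) => y /fg.
have cont f1 g1 : (forall x, D x -> f1 x = g1 x) ->
    (forall x, D x -> {for x, continuous f1}) ->
    forall x, D x -> {for x, continuous g1}.
  move=> fg cf x Dx; rewrite /prop_for /continuous_at -fg//.
  apply: cvg_trans (cf x Dx).
  exact: (@near_eq_cvg _ _ _ (nbhs_filter x) _ _ (near_fg _ _ _ fg Dx)).
elim: k f g => [|k IH] f g fg [cf H]; split=> //; try exact: cont fg cf.
move=> i.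
have [dfi Hi] := H i; split=> [x Dx|].
  exact: near_eq_derivable (near_fg _ _ _ fg Dx) (dfi x Dx).
by apply: IH Hi => x Dx; apply: near_eq_derive; exact: near_fg.
Qed.

Lemma Ck_differentiable k f x : Ck D k.+1 f -> D x -> differentiable f x.
Proof.
move=> [_ H] Dx; apply: differentiable_C1.
  by apply: filterS (near_open Dx) => y Dy i; have [+ _] := H i; apply.
by move=> i; have [_ /Ck_continuous] := H i; apply.
Qed.

Lemma CkD k f g : Ck D k f -> Ck D k g -> Ck D k (fun x => f x + g x).
Proof.
elim: k f g => [|k IH] f g [cf Hf] [cg Hg]; split=> //.
- by move=> x Dx; apply: continuousD; [exact: cf|exact: cg].
- by move=> x Dx; apply: continuousD; [exact: cf|exact: cg].
move=> i; have [df Hfi] := Hf i; have [dg Hgi] := Hg i.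
split=> [x Dx|]; first by apply: derivableD; [exact: df|exact: dg].
apply: Ck_congr (IH _ _ Hfi Hgi) => x Dx.
by rewrite deriveD//; [exact: df|exact: dg].
Qed.

Lemma CkM k f g : Ck D k f -> Ck D k g -> Ck D k (fun x => f x * g x).
Proof.
elim: k f g => [|k IH] f g Cf Cg.
  by split=> // x Dx; apply: continuousM;
    [exact: Ck_continuous Cf _|exact: Ck_continuous Cg _].
have C1f := CkS Cf; have C1g := CkS Cg.
move: Cf Cg => [cf Hf] [cg Hg]; split=> //.
  by move=> x Dx; apply: continuousM; [exact: cf|exact: cg].
move=> i; have [df Hfi] := Hf i; have [dg Hgi] := Hg i.
split=> [x Dx|]; first by apply: derivableM; [exact: df|exact: dg].
apply: Ck_congr (CkD (IH _ _ C1f Hgi) (IH _ _ C1g Hfi)) => x Dx.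
by rewrite deriveM//; [exact: df|exact: dg].
Qed.

Lemma Ck_sum k I (r : seq I) (P : pred I) (F : I -> 'rV[R]_m -> R) :
  (forall i, P i -> Ck D k (F i)) -> Ck D k (fun x => \sum_(i <- r | P i) F i x).
Proof.
move=> HF; elim: r => [|i r IH].
  by apply: Ck_congr (Ck_cst k 0) => x Dx; rewrite big_nil.
have [Pi|Pi] := boolP (P i).
  by apply: Ck_congr (CkD (HF _ Pi) IH) => x Dx; rewrite big_cons Pi.
by apply: Ck_congr IH => x Dx; rewrite big_cons (negbTE Pi).
Qed.

End Ck_theory.

(** The partial derivatives of [f \o phi] are sums of products of partial
    derivatives of [phi] with composites of the same kind and of lower order. *)
Lemma Ck_comp (R : realType) (m p : nat) (D : set 'rV[R]_m) (E : set 'rV[R]_p)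
    (f : 'rV[R]_m -> R) (phi : 'rV[R]_p -> 'rV[R]_m) k :
  open D -> open E -> (forall x, E x -> D (phi x)) ->
  (forall j, Ck E k (fun x => phi x 0 j)) -> Ck D k f -> Ck E k (f \o phi).
Proof.
move=> oD oE ED.
elim: k f => [|k IH] f Cphi Cf.
  split=> // x Ex; apply: continuous_comp; last first.
    by apply: Ck_continuous Cf _; exact: ED.
  by apply: continuous_row => j; exact: Ck_continuous (Cphi j) _.
have dphi x i : E x -> derivable phi x (delta_mx 0 i).
  move=> Ex; apply/derivable_rowP => j.
  by have [_ /(_ i)[+ _]] := Cphi j; apply.
have df x : E x -> differentiable f (phi x).
  by move=> Ex; apply: (Ck_differentiable oD Cf); exact: ED.
split=> [x Ex|i].
  apply: continuous_comp; last by apply: Ck_continuous Cf _; exact: ED.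
  by apply: continuous_row => j; exact: Ck_continuous (Cphi j) _.
split=> [x Ex|]; first by have [] := is_derive_chain (dphi x i Ex) (df x Ex).
apply: (@Ck_congr _ _ _ oE _ (fun x => \sum_j 'D_(delta_mx 0 i) (fun x => phi x 0 j) x
   * ('D_(delta_mx 0 j) f \o phi) x)).
  move=> x Ex; have [_ ->] := is_derive_chain (dphi x i Ex) (df x Ex).
  rewrite derive_lin; last exact: df.
  by apply: eq_bigr => j _; rewrite derive_rowE//; exact: dphi.
apply: Ck_sum => // j _; apply: CkM => //.
  by have [_ /(_ i)[_]] := Cphi j.
apply: IH; last by have [_ /(_ j)[_]] := Cf.
by move=> j'; exact: CkS.
Qed.

(** * Schwarz's theorem and smooth functions *)

(** Two applications of the mean value theorem, first along [u] and then along
    [v].  The left-hand side is symmetric in [u] and [v], the right-hand side is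
    not. *)
Lemma second_difference (R : realType) (V : normedModType R) (f : V -> R)
    (x u v : V) (s : R) :
  (forall a b, `|a| <= `|s| -> `|b| <= `|s| ->
     derivable f (x + a *: u + b *: v) u /\
     derivable ('D_u f) (x + a *: u + b *: v) v) ->
  exists a b d, [/\ `|a| <= `|s|, `|b| <= `|s|,
    d = 'D_v ('D_u f) (x + a *: u + b *: v) &
    f (x + s *: u + s *: v) - f (x + s *: u) - (f (x + s *: v) - f x)
      = d * s * s].
Proof.
move=> H.
have du (t b : R) : `|t| <= `|s| -> `|b| <= `|s| ->
    is_derive t (1:R) (fun t : R => f (x + t *: u + b *: v))
      ('D_u f (x + t *: u + b *: v)).
  move=> ts bs.
  have -> : (fun t => f (x + t *: u + b *: v))
      = (fun t => f (x + b *: v + t *: u)).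
    by apply/funext => t'; rewrite addrAC.
  rewrite addrAC; apply: is_derive_line; rewrite addrAC.
  by have [] := H _ _ ts bs.
have s0 : `|0 : R| <= `|s| by rewrite normr0.
have dphi (t : R) : `|t| <= `|s| -> is_derive t (1 : R)
    (fun t : R => f (x + t *: u + s *: v) - f (x + t *: u + 0 *: v))
    ('D_u f (x + t *: u + s *: v) - 'D_u f (x + t *: u + 0 *: v)).
  by move=> ts; apply: is_deriveB; exact: du.
have [t /dphi []//|a ha] := @MVT0 R
  (fun t => f (x + t *: u + s *: v) - f (x + t *: u + 0 *: v)) s.
have [_ ->] := dphi a ha.
have [t ts|b hb E] := @MVT0 R (fun t => 'D_u f (x + a *: u + t *: v)) s.
  have [_ d2] := H _ _ ha ts.
  by have [] := is_derive_line d2.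
rewrite E; have [_ d2] := H _ _ ha hb.
have [_ ->] := is_derive_line d2.
rewrite !scale0r !addr0 => E'.
by do 3 eexists; split; [exact: ha|exact: hb|reflexivity|exact: E'].
Qed.

(** Schwarz's theorem: both iterated derivatives at [x] are limits of the same
    second difference quotient. *)
Lemma partial_commute (R : realType) (m : nat) (D : set 'rV[R]_m)
    (f : 'rV[R]_m -> R) (i j : 'I_m) (x : 'rV[R]_m) : open D ->
  smooth_on D f -> D x ->
  'D_(delta_mx 0 i) ('D_(delta_mx 0 j) f) x =
  'D_(delta_mx 0 j) ('D_(delta_mx 0 i) f) x.
Proof.
move=> oD sf Dx.
set u : 'rV[R]_m := delta_mx 0 i; set v : 'rV[R]_m := delta_mx 0 j.
have nu : `|u| <= 1.
  by apply: norm_row_le => // k; rewrite mxE; case: eqP => _; case: eqP => _;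
    rewrite /= ?normr0 ?normr1.
have nv : `|v| <= 1.
  by apply: norm_row_le => // k; rewrite mxE; case: eqP => _; case: eqP => _;
    rewrite /= ?normr0 ?normr1.
have cont k l : {for x, continuous ('D_(delta_mx 0 k) ('D_(delta_mx 0 l) f))}.
  by have [] := smooth_on_partial k (smooth_on_partial l sf) [::] Dx.
have der y k : D y -> derivable f y (delta_mx 0 k).
  by move=> Dy; have [_ +] := sf [::] _ Dy; apply.
have der2 y k l : D y -> derivable ('D_(delta_mx 0 l) f) y (delta_mx 0 k).
  by move=> Dy; have [_ +] := smooth_on_partial l sf [::] Dy; apply.
apply/eqP; rewrite -subr_eq0 -normr_le0; apply/ler_addgt0Pr => e e0; rewrite add0r.
have e2 : 0 < e / 2 by rewrite divr_gt0.
have /nbhs_ballP[d /= d0 Hd] : \forall y \near x, D y /\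
    (`|'D_u ('D_v f) x - 'D_u ('D_v f) y| <= e / 2 /\
     `|'D_v ('D_u f) x - 'D_v ('D_u f) y| <= e / 2).
  apply: filterI; first exact: near_open.
  apply: filterI.
    by have /cvgrPdist_le := cont i j; apply.
  by have /cvgrPdist_le := cont j i; apply.
(* The increments have norm at most [2 * s < d], as [u] and [v] have norm at
   most 1. *)
pose s := d / 3.
have s0 : 0 < s by rewrite divr_gt0.
have inb a b : `|a| <= `|s| -> `|b| <= `|s| -> ball x d (x + a *: u + b *: v).
  rewrite (gtr0_norm s0) => as_ bs; rewrite -ball_normE /= -addrA opprD addNKr.
  rewrite normrN (le_lt_trans (ler_normD _ _))// !normrZ.
  apply: (@le_lt_trans _ _ (s * 1 + s * 1)); first by rewrite lerD// ler_pM.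
  by rewrite !mulr1 -mulr2n -mulr_natr /s -mulrA gtr_pMr// mulrC
    ltr_pdivrMr// mul1r ltr_nat.
have [a b as_ bs|a [b [A [ha hb EA E]]]] := @second_difference R _ f x u v s.
  by have [Dy _] := Hd _ (inb _ _ as_ bs); split; [exact: der|exact: der2].
have [a' b'|a' [b' [B [ha' hb' EB E']]]] := @second_difference R _ f x v u s.
  move=> as_ bs; have [Dy _] := Hd _ (inb _ _ bs as_).
  by rewrite addrAC; split; [exact: der|exact: der2].
have [_ [_ ]] := Hd _ (inb _ _ ha hb); rewrite -EA => H1.
have [_ []] := Hd _ (inb _ _ hb' ha'); rewrite addrAC -EB => H2 _.
have swap (p q r t : R) : p - q - (r - t) = p - r - (q - t).
  by rewrite !opprB addrACA [RHS]addrACA; congr (_ + _); rewrite addrC.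
have EE : A = B.
  have sn0 := lt0r_neq0 s0; apply: (mulIf sn0); apply: (mulIf sn0).
  by rewrite -E -E' swap [x + s *: v + s *: u]addrAC.
apply: (le_trans (ler_distD B _ _)); rewrite (splitr e); apply: lerD.
  exact: H2.
by rewrite (distrC B) -EE; exact: H1.
Qed.

Section smooth_on_theory.
Context (R : realType) (m : nat) (D : set 'rV[R]_m).
Implicit Types (f g : 'rV[R]_m -> R).

Lemma smooth_onS (E : set 'rV[R]_m) f : E `<=` D -> smooth_on D f -> smooth_on E f.
Proof. by move=> ED sf s x /ED; exact: sf. Qed.

Lemma smooth_on_cst (a : R) : smooth_on D (cst a).
Proof. by apply/smooth_onP => k; exact: Ck_cst. Qed.

Lemma smooth_on_coord j : smooth_on D (fun x => x 0 j).
Proof. by apply/smooth_onP => k; exact: Ck_coord. Qed.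

Context (oD : open D).

Lemma smooth_on_congr f g : (forall x, D x -> f x = g x) ->
  smooth_on D f -> smooth_on D g.
Proof.
by move=> fg /smooth_onP sf; apply/smooth_onP => k; exact: Ck_congr (sf k).
Qed.

Lemma smooth_onD f g : smooth_on D f -> smooth_on D g ->
  smooth_on D (fun x => f x + g x).
Proof.
move=> /smooth_onP sf /smooth_onP sg; apply/smooth_onP => k.
by apply: CkD.
Qed.

Lemma smooth_onM f g : smooth_on D f -> smooth_on D g ->
  smooth_on D (fun x => f x * g x).
Proof.
move=> /smooth_onP sf /smooth_onP sg; apply/smooth_onP => k.
by apply: CkM.
Qed.

Lemma smooth_on_sum I (r : seq I) (P : pred I) (F : I -> 'rV[R]_m -> R) :
  (forall i, P i -> smooth_on D (F i)) ->
  smooth_on D (fun x => \sum_(i <- r | P i) F i x).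
Proof.
move=> sF; apply/smooth_onP => k; apply: Ck_sum => // i Pi.
by have /smooth_onP := sF i Pi.
Qed.

Lemma smooth_on_differentiable f x : smooth_on D f -> D x -> differentiable f x.
Proof. by move=> /smooth_onP /(_ 1%N) sf; exact: Ck_differentiable sf. Qed.

Lemma smooth_on_derive f w : smooth_on D f -> smooth_on D ('D_w f).
Proof.
move=> sf.
apply: (@smooth_on_congr (fun x => \sum_i w 0 i * 'D_(delta_mx 0 i) f x)).
  by move=> x Dx; rewrite [RHS]derive_lin//; exact: smooth_on_differentiable.
apply: smooth_on_sum => i _; apply: smooth_onM; first exact: smooth_on_cst.
exact: smooth_on_partial.
Qed.

Lemma smooth_map_on_derivable p (phi : 'rV[R]_m -> 'rV[R]_p) x w :
  smooth_map_on D phi -> D x -> derivable phi x w.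
Proof.
move=> sphi Dx; apply/derivable_rowP => j; apply: diff_derivable.
exact: smooth_on_differentiable (sphi j) Dx.
Qed.

Lemma smooth_on_comp p (E : set 'rV[R]_p) (f : 'rV[R]_p -> R)
    (phi : 'rV[R]_m -> 'rV[R]_p) :
  open E -> (forall x, D x -> E (phi x)) ->
  smooth_map_on D phi -> smooth_on E f -> smooth_on D (f \o phi).
Proof.
move=> oE DE sphi /smooth_onP sf; apply/smooth_onP => k.
by apply: Ck_comp oE oD DE _ (sf k) => j; have /smooth_onP := sphi j.
Qed.

End smooth_on_theory.

#[local] Opaque derive.

Section smooth_maps.
Context (R : realType).

Lemma smooth_on_local (m : nat) (D : set 'rV[R]_m) (f : 'rV[R]_m -> R) :
  (forall x, D x -> exists2 E, E x & smooth_on E f) -> smooth_on D f.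
Proof. by move=> H s x Dx; have [E Ex sf] := H x Dx; exact: sf. Qed.

Lemma derive_commute (m : nat) (D : set 'rV[R]_m) (f : 'rV[R]_m -> R)
    (v w x : 'rV[R]_m) : open D -> smooth_on D f -> D x ->
  'D_v ('D_w f) x = 'D_w ('D_v f) x.
Proof.
move=> oD sf Dx.
have [H HE] : exists H : 'I_m -> 'I_m -> R,
    forall k i, H k i = 'D_(delta_mx 0 k) ('D_(delta_mx 0 i) f) x.
  by exists (fun k i => 'D_(delta_mx 0 k) ('D_(delta_mx 0 i) f) x).
have Hsym k i : H k i = H i k.
  by rewrite !HE; exact: (partial_commute k i oD sf Dx).
have dp k : differentiable ('D_(delta_mx 0 k) f) x.
  exact: (smooth_on_differentiable oD (smooth_on_partial k sf) Dx).
have sD u : differentiable ('D_u f) x.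
  exact: (smooth_on_differentiable oD (smooth_on_derive oD u sf) Dx).
have expand (u : 'rV[R]_m) (k : 'I_m) :
    'D_(delta_mx 0 k) ('D_u f) x = \sum_i u 0 i * H k i.
  have -> : 'D_(delta_mx 0 k) ('D_u f) x = 'D_(delta_mx 0 k)
      (\sum_(i < m) (u 0 i *: ('D_(delta_mx 0 i) f) : 'rV[R]_m -> R)) x.
    apply: near_eq_derive; apply: filterS (near_open oD Dx) => t Dt.
    rewrite fct_sumE.
    exact: derive_lin (smooth_on_differentiable oD sf Dt).
  rewrite derive_sum => [|i]; last first.
    by apply: derivableZ; apply: diff_derivable; exact: dp.
  apply: eq_bigr => i _; rewrite HE deriveZ; first by [].
  by apply: diff_derivable; exact: dp.
have double u u' : 'D_u ('D_u' f) x = \sum_i \sum_j u 0 i * (u' 0 j * H i j).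
  apply: (etrans (derive_lin u (sD u'))).
  by apply: eq_bigr => i _; rewrite (expand u' i) mulr_sumr.
rewrite (double v w) (double w v) exchange_big /=.
apply: eq_bigr => j _; apply: eq_bigr => i _.
by rewrite mulrCA Hsym.
Qed.

Lemma smooth_row_mx_l (m p : nat) (D : set 'rV[R]_m) (y : 'rV[R]_p) :
  smooth_map_on D (fun x : 'rV[R]_m => row_mx x y).
Proof.
move=> j; case: (split_ordP j) => k ->.
  have -> : (fun x : 'rV[R]_m => row_mx x y 0 (lshift p k))
     = (fun x => x 0 k) by apply/funext => x; rewrite row_mxEl.
  exact: smooth_on_coord.
have -> : (fun x : 'rV[R]_m => row_mx x y 0 (rshift m k))
   = cst (y 0 k) by apply/funext => x; rewrite row_mxEr.
exact: smooth_on_cst.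
Qed.

Lemma smooth_row_mx_r (m p : nat) (D : set 'rV[R]_p) (x : 'rV[R]_m) :
  smooth_map_on D (fun y : 'rV[R]_p => row_mx x y).
Proof.
move=> j; case: (split_ordP j) => k ->.
  have -> : (fun y : 'rV[R]_p => row_mx x y 0 (lshift p k))
     = cst (x 0 k) by apply/funext => y; rewrite row_mxEl.
  exact: smooth_on_cst.
have -> : (fun y : 'rV[R]_p => row_mx x y 0 (rshift m k))
   = (fun y => y 0 k) by apply/funext => y; rewrite row_mxEr.
exact: smooth_on_coord.
Qed.

Lemma smooth_lsubmx (m p : nat) (D : set 'rV[R]_(m + p)) :
  smooth_map_on D (fun x : 'rV[R]_(m + p) => lsubmx x).
Proof.
move=> j; have -> : (fun x : 'rV[R]_(m + p) => lsubmx x 0 j)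
   = (fun x => x 0 (lshift p j)) by apply/funext => x; rewrite mxE.
exact: smooth_on_coord.
Qed.

Lemma smooth_rsubmx (m p : nat) (D : set 'rV[R]_(m + p)) :
  smooth_map_on D (fun x : 'rV[R]_(m + p) => rsubmx x).
Proof.
move=> j; have -> : (fun x : 'rV[R]_(m + p) => rsubmx x 0 j)
   = (fun x => x 0 (rshift m j)) by apply/funext => x; rewrite mxE.
exact: smooth_on_coord.
Qed.

Lemma smooth_map_continuous (m p : nat) (D : set 'rV[R]_m)
    (phi : 'rV[R]_m -> 'rV[R]_p) x : smooth_map_on D phi -> D x ->
  {for x, continuous phi}.
Proof.
move=> sphi Dx; apply: continuous_row => j.
by have [] := sphi j [::] x Dx.
Qed.

Lemma open_preimage_smooth (m p : nat) (D : set 'rV[R]_p)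
    (phi : 'rV[R]_m -> 'rV[R]_p) : smooth_map_on setT phi -> open D ->
  open (phi @^-1` D).
Proof.
move=> sphi oD; apply: open_comp => // x _.
exact: (smooth_map_continuous sphi).
Qed.

Lemma derive_row_mx_r (m p : nat) (W : normedModType R)
    (f : 'rV[R]_(m + p) -> W) (x : 'rV[R]_m) (y w : 'rV[R]_p) :
  'D_w (fun y => f (row_mx x y)) y = 'D_(row_mx 0 w) f (row_mx x y).
Proof.
apply: (etrans (derive_lineE _ _ _) (etrans _ (esym (derive_lineE _ _ _)))).
apply: (congr1 (fun F : R -> W => 'D_1 F 0)); apply/funext => h.
by rewrite scale_row_mx add_row_mx scaler0 add0r.
Qed.

Lemma derive_row_mx_l (m p : nat) (W : normedModType R)
    (f : 'rV[R]_(m + p) -> W) (x w : 'rV[R]_m) (y : 'rV[R]_p) :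
  'D_w (fun x => f (row_mx x y)) x = 'D_(row_mx w 0) f (row_mx x y).
Proof.
apply: (etrans (derive_lineE _ _ _) (etrans _ (esym (derive_lineE _ _ _)))).
apply: (congr1 (fun F : R -> W => 'D_1 F 0)); apply/funext => h.
by rewrite scale_row_mx add_row_mx scaler0 add0r.
Qed.

End smooth_maps.

(** * Charts *)

Section charts.
Context (R : realType) (m : nat) (T : topologicalType) (c : chart R m T).
Context (hc : is_chart c).

Lemma chart_mapK x : chart_dom c x -> chart_inv c (chart_map c x) = x.
Proof. by have [_ _ + _ _] := hc; apply. Qed.

Lemma chart_codom_map x : chart_dom c x -> chart_codom c (chart_map c x).
Proof. by move=> cx; exists x. Qed.

Lemma chart_dom_inv y : chart_codom c y -> chart_dom c (chart_inv c y).
Proof. by case=> x cx <-; rewrite chart_mapK. Qed.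

Lemma chart_invK y : chart_codom c y -> chart_map c (chart_inv c y) = y.
Proof. by case=> x cx <-; rewrite chart_mapK. Qed.

Lemma open_chart_dom : open (chart_dom c). Proof. by have [] := hc. Qed.

Lemma open_chart_codom : open (chart_codom c). Proof. by have [] := hc. Qed.

Lemma chart_inv_continuous y : chart_codom c y -> {for y, continuous (chart_inv c)}.
Proof.
move=> cy; have [_ o _ _] := hc; rewrite continuous_open_subspace//.
by apply; rewrite inE.
Qed.

End charts.

Lemma prod_chart_codomE (R : realType) (m p : nat) (T U : Type)
    (c : chart R m T) (d : chart R p U) (y : 'rV[R]_(m + p)) :
  chart_codom (prod_chart c d) y <->
  chart_codom c (lsubmx y) /\ chart_codom d (rsubmx y).
Proof.
split=> [[[a b] [/= ca db] <-]|[[a ca ay] [b db bd]]].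
  by rewrite row_mxKl row_mxKr; split; [exists a|exists b].
by exists (a, b) => //=; rewrite ay bd hsubmxK.
Qed.

(** * Left-invariant fields in charts *)

Section lie_group.
Context (R : realType) (n : nat) (G : lieGroupType R n).
Implicit Types c d : chart R n G.

Lemma atlasP : is_smooth_atlas (atlas G).
Proof. exact: lie_atlasP. Qed.

Lemma atlas_chart c : atlas G c -> is_chart c.
Proof. by have [+ _ _] := atlasP; apply. Qed.

Lemma atlas_cover (a : G) : exists2 c, atlas G c & chart_dom c a.
Proof. by have [_ + _] := atlasP; apply. Qed.

Definition mul_dom c c' d : set 'rV[R]_(n + n) :=
  chart_codom (prod_chart c c') `&` [set y | chart_dom d
    (chart_inv c (lsubmx y) * chart_inv c' (rsubmx y))%g].

Definition mul_chart c c' d (y : 'rV[R]_(n + n)) : 'rV[R]_n :=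
  chart_map d (chart_inv c (lsubmx y) * chart_inv c' (rsubmx y))%g.

Lemma smooth_mul_chart c c' d : atlas G c -> atlas G c' -> atlas G d ->
  smooth_map_on (mul_dom c c' d) (mul_chart c c' d).
Proof.
move=> Ac Ac' Ad; have := @lie_mul_smooth R n G (prod_chart c c') d _ Ad.
by apply; exists c, c'.
Qed.

Lemma mul_domP c c' d y : mul_dom c c' d y <->
  [/\ chart_codom c (lsubmx y), chart_codom c' (rsubmx y) &
      chart_dom d (chart_inv c (lsubmx y) * chart_inv c' (rsubmx y))%g].
Proof.
split=> [[/prod_chart_codomE[]]//|[? ? ?]]; split=> //.
exact/prod_chart_codomE.
Qed.

Lemma open_mul_dom c c' d : atlas G c -> atlas G c' -> atlas G d ->
  open (mul_dom c c' d).
Proof.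
move=> Ac Ac' Ad.
have hc := atlas_chart Ac; have hc' := atlas_chart Ac'.
have hd := atlas_chart Ad.
have cl (y : 'rV[R]_(n + n)) : {for y, continuous (fun y : 'rV[R]_(n + n) => lsubmx y)}.
  exact: (@smooth_map_continuous _ _ _ setT _ y (@smooth_lsubmx _ _ _ setT)).
have cr (y : 'rV[R]_(n + n)) : {for y, continuous (fun y : 'rV[R]_(n + n) => rsubmx y)}.
  exact: (@smooth_map_continuous _ _ _ setT _ y (@smooth_rsubmx _ _ _ setT)).
rewrite openE => y /mul_domP[cy cy' dy].
have cil : {for y, continuous (fun y : 'rV[R]_(n + n) => chart_inv c (lsubmx y))}.
  by apply: continuous_comp; [exact: cl|exact: chart_inv_continuous].
have cir : {for y, continuous (fun y : 'rV[R]_(n + n) => chart_inv c' (rsubmx y))}.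
  by apply: continuous_comp; [exact: cr|exact: chart_inv_continuous].
have N1 : \forall z \near y, chart_codom c (lsubmx z).
  by apply: cl; exact: (near_open (open_chart_codom hc) cy).
have N2 : \forall z \near y, chart_codom c' (rsubmx z).
  by apply: cr; exact: (near_open (open_chart_codom hc') cy').
have N3 : \forall z \near y,
    chart_dom d (chart_inv c (lsubmx z) * chart_inv c' (rsubmx z))%g.
  have cm : {for y, continuous ((fun ab : G * G => ab.1 * ab.2)%g \o
      (fun y : 'rV[R]_(n + n) =>
        (chart_inv c (lsubmx y), chart_inv c' (rsubmx y))))}.
    by apply: continuous_comp; [exact: (cvg_pair cil cir)|exact: lie_mul_continuous].
  apply: cm.
  by apply: open_nbhs_nbhs; split=> //; exact: open_chart_dom.
apply: filterS (filterI N1 (filterI N2 N3)) => z [z1 [z2 z3]].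
exact/mul_domP.
Qed.

(** The chart expression of [y |-> f (b * y)] is [f] after the chart expression
    of the multiplication with its first argument frozen. *)
Lemma smooth_translate (b : G) (f : G -> R) : smooth_fun (atlas G) f ->
  smooth_fun (atlas G) (fun a => f (b * a)%g).
Proof.
move=> sf c' Ac'; have [c Ac cb] := atlas_cover b.
have hc := atlas_chart Ac; have hc' := atlas_chart Ac'.
apply: smooth_on_local => y c'y.
have [d Ad dy] := atlas_cover (b * chart_inv c' y)%g.
have hd := atlas_chart Ad.
pose phi (y : 'rV[R]_n) := row_mx (chart_map c b) y.
have domE z : chart_codom c' z -> chart_dom d (b * chart_inv c' z)%g ->
    mul_dom c c' d (phi z).
  move=> c'z dz; apply/mul_domP; rewrite /phi row_mxKl row_mxKr.
  by rewrite chart_mapK//; split=> //; exact: chart_codom_map.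
have oM := open_mul_dom Ac Ac' Ad.
have oE : open (phi @^-1` mul_dom c c' d).
  by apply: open_preimage_smooth => //; exact: smooth_row_mx_r.
exists (phi @^-1` mul_dom c c' d); first exact: domE.
apply: (@smooth_on_congr _ _ _ oE ((f \o chart_inv d) \o (mul_chart c c' d \o phi))).
  move=> z /mul_domP[]; rewrite /phi row_mxKl row_mxKr chart_mapK// => _ c'z dz.
  by rewrite /= /mul_chart row_mxKl row_mxKr chart_mapK// chart_mapK.
apply: (smooth_on_comp oE (open_chart_codom hd)) (sf _ Ad).
  move=> z /mul_domP[_ _ dz]; exact: chart_codom_map.
move=> j; apply: (smooth_on_comp oE oM (f := fun y => mul_chart c c' d y 0 j)) => //.
  exact: smooth_row_mx_r.
exact: smooth_mul_chart.
Qed.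

(** By left invariance, [X f (a) = X (f (a *_)) (1)], so that the coefficients of
    [X] in a chart are partial derivatives of the multiplication map; hence they
    are smooth. *)
Lemma left_invariant_chart (X : operator R G) (c : chart R n G) :
  left_invariant_field X -> atlas G c ->
  exists2 b : 'rV[R]_n -> 'rV[R]_n, smooth_map_on (chart_codom c) b &
    forall f u, smooth_fun (atlas G) f -> chart_codom c u ->
      X f (chart_inv c u) = 'D_(b u) (f \o chart_inv c) u.
Proof.
move=> [[tX _] LX] Ac; have hc := atlas_chart Ac.
have [c1 [w1 [A1 c11 XE]]] := tX (1%g : G).
have h1 := atlas_chart A1.
pose y1 := chart_map c1 (1%g : G).
pose psi (u : 'rV[R]_n) := row_mx u y1.
have oM := open_mul_dom Ac A1 Ac.
have sM := smooth_mul_chart Ac A1 Ac.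
have domE u : chart_codom c u -> mul_dom c c1 c (psi u).
  move=> cu; apply/mul_domP; rewrite /psi row_mxKl row_mxKr.
  rewrite /y1 chart_mapK// mulg1; split=> //; first exact: chart_codom_map.
  exact: chart_dom_inv.
exists (fun u => 'D_(row_mx 0 w1) (mul_chart c c1 c) (psi u)).
  move=> j.
  apply: (@smooth_on_congr _ _ _ (open_chart_codom hc)
    ('D_(row_mx 0 w1) (fun y => mul_chart c c1 c y 0 j) \o psi)).
    move=> u cu; rewrite /= derive_rowE//.
    exact: (smooth_map_on_derivable oM sM (domE _ cu)).
  apply: (smooth_on_comp (open_chart_codom hc) oM) => //.
    exact: smooth_row_mx_l.
  by apply: smooth_on_derive => //; exact: sM.
move=> f u sf cu.
rewrite -[chart_inv c u]mulg1 -(LX _ _ sf) XE; last exact: smooth_translate.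
rewrite -/y1.
pose mu y := mul_chart c c1 c (row_mx u y).
have mu1 : mu y1 = u.
  rewrite /mu /mul_chart row_mxKl row_mxKr /y1 chart_mapK// mulg1.
  exact: chart_invK.
have dmu : derivable mu y1 w1.
  have : derivable (mul_chart c c1 c) (psi u) (row_mx 0 w1).
    exact: (smooth_map_on_derivable oM sM (domE _ cu)).
  move=> /derivable1P dm; apply/derivable1P.
  rewrite (_ : (fun h : R => mu (h *: w1 + y1)) =
    (fun h : R => mul_chart c c1 c (h *: row_mx 0 w1 + psi u))); first exact: dm.
  apply/funext => h.
  by rewrite /mu /psi scale_row_mx add_row_mx scaler0 add0r.
have df : differentiable (f \o chart_inv c) (mu y1).
  by rewrite mu1; apply: smooth_on_differentiable (sf _ Ac) cu; exact: open_chart_codom.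
transitivity ('D_w1 ((f \o chart_inv c) \o mu) y1); last first.
  have [_ ->] := is_derive_chain dmu df.
  by rewrite mu1 /mu derive_row_mx_r.
apply: near_eq_derive.
have oE : open ((fun y : 'rV[R]_n => row_mx u y) @^-1` mul_dom c c1 c).
  by apply: open_preimage_smooth => //; exact: smooth_row_mx_r.
apply: filterS (near_open oE (domE _ cu)) => y /mul_domP[_ _].
rewrite row_mxKl row_mxKr /mu /mul_chart /= row_mxKl row_mxKr => dy.
by rewrite chart_mapK.
Qed.

End lie_group.

(** * Vertical and left-invariant fields on the phase space *)

Lemma deriveM_cst (R : realType) (V : normedModType R) (f h : V -> R) (u w : V) :
  is_derive u w f 0 -> derivable h u w ->
  'D_w (fun t => f t * h t) u = f u * 'D_w h u.
Proof.
move=> [df f0] dh; rewrite (deriveM df dh) f0.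
by rewrite [_ *: 0]mulr0 addr0.
Qed.

Section phase_space.
Context (R : realType) (n : nat) (G : lieGroupType R n) (g : vectType R)
  (lv : g -> operator R G) (e : n.-tuple g).
Context (basis_e : basis_of fullv e).
Implicit Types (c : chart R n G) (F H : G * g -> R) (x z v w : g) (p : G * g).

Local Notation smoothP := (smooth_fun (phase_atlas G e)).
Local Notation cvec := (chart_map (coord_chart e)).
Local Notation vec := (chart_inv (coord_chart e)).
Local Notation pchart c := (prod_chart c (coord_chart e)).

Lemma cvecK z : vec (cvec z) = z.
Proof.
rewrite {2}(coord_basis basis_e (memvf z)).
by apply: eq_bigr => k _; rewrite mxE.
Qed.

Lemma vecK y : cvec (vec y) = y.
Proof.
apply/rowP => k; rewrite mxE coord_sum_free//; exact: basis_free basis_e.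
Qed.

Lemma cvec_linear a x y : cvec (a *: x + y) = a *: cvec x + cvec y.
Proof. by apply/rowP => k; rewrite !mxE linearP. Qed.

Lemma phase_codomE c y : chart_codom (pchart c) y <-> chart_codom c (lsubmx y).
Proof.
rewrite prod_chart_codomE; split=> [[]//|cy]; split=> //.
by exists (vec (rsubmx y)); rewrite ?vecK.
Qed.

Lemma open_phase_codom c : atlas G c -> open (chart_codom (pchart c)).
Proof.
move=> Ac.
have -> : chart_codom (pchart c) = (fun y => lsubmx y) @^-1` chart_codom c.
  by apply/seteqP; split => y /phase_codomE.
apply: open_preimage_smooth; first exact: smooth_lsubmx.
exact: open_chart_codom (atlas_chart Ac).
Qed.

Lemma smooth_phaseP F : smoothP F <-> (forall c, atlas G c ->
  smooth_on (chart_codom (pchart c)) (F \o chart_inv (pchart c))).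
Proof.
split=> [sF c Ac|H _ [c [d [Ac -> ->]]]]; last exact: H.
by apply: sF; exists c, (coord_chart e).
Qed.

Lemma phase_inv_map c p : atlas G c -> chart_dom c p.1 ->
  chart_inv (pchart c) (row_mx (chart_map c p.1) (cvec p.2)) = p.
Proof.
move=> Ac cp; rewrite /= row_mxKl row_mxKr chart_mapK//; last exact: atlas_chart.
by rewrite -[X in (_, X)]/(vec (cvec p.2)) cvecK; case: p cp.
Qed.

Lemma phase_cover p : exists c y, [/\ atlas G c, chart_codom (pchart c) y &
  p = chart_inv (pchart c) y].
Proof.
have [c Ac cp] := atlas_cover p.1.
exists c, (row_mx (chart_map c p.1) (cvec p.2)); split=> //.
  by apply/phase_codomE; rewrite row_mxKl; exact: chart_codom_map.
by rewrite phase_inv_map.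
Qed.

Lemma smooth_phase_slice F z : smoothP F -> smooth_fun (atlas G) (fun a => F (a, z)).
Proof.
move=> /smooth_phaseP sF c Ac.
have oc := open_chart_codom (atlas_chart Ac).
apply: (@smooth_on_congr _ _ _ oc ((F \o chart_inv (pchart c)) \o
    (fun u : 'rV[R]_n => row_mx u (cvec z)))).
  by move=> u cu; rewrite /= row_mxKl row_mxKr -[X in F (_, X)]/(vec (cvec z)) cvecK.
apply: (smooth_on_comp oc (open_phase_codom Ac)) (sF _ Ac).
  by move=> u cu; apply/phase_codomE; rewrite row_mxKl.
exact: smooth_row_mx_l.
Qed.

Lemma smooth_phase_cst (a : R) : smoothP (fun=> a).
Proof. by apply/smooth_phaseP => c Ac; exact: smooth_on_cst. Qed.

Lemma smooth_phaseD F H : smoothP F -> smoothP H -> smoothP (fun p => F p + H p).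
Proof.
move=> /smooth_phaseP sF /smooth_phaseP sH; apply/smooth_phaseP => c Ac.
exact: (smooth_onD (open_phase_codom Ac) (sF c Ac) (sH c Ac)).
Qed.

Lemma smooth_phaseM F H : smoothP F -> smoothP H -> smoothP (fun p => F p * H p).
Proof.
move=> /smooth_phaseP sF /smooth_phaseP sH; apply/smooth_phaseP => c Ac.
exact: (smooth_onM (open_phase_codom Ac) (sF c Ac) (sH c Ac)).
Qed.

Lemma smooth_phase_sum I (r : seq I) (P : pred I) (F : I -> G * g -> R) :
  (forall i, P i -> smoothP (F i)) -> smoothP (fun p => \sum_(i <- r | P i) F i p).
Proof.
move=> sF; apply/smooth_phaseP => c Ac.
apply: (@smooth_on_sum _ _ _ (open_phase_codom Ac) I r P
  (fun i => F i \o chart_inv (pchart c))) => i Pi.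
by have /smooth_phaseP := sF i Pi; apply.
Qed.

Lemma smooth_phase_coord k : smoothP (fun p => coord e k p.2).
Proof.
apply/smooth_phaseP => c Ac.
rewrite (_ : _ \o _ = fun y : 'rV[R]_(n + n) => y 0 (rshift n k)).
  exact: smooth_on_coord.
apply/funext => y /=; rewrite coord_sum_free ?mxE//; exact: basis_free basis_e.
Qed.

Lemma phase_inv_line c x (y : 'rV[R]_(n + n)) (s : R) :
  ((chart_inv (pchart c) y).1, (chart_inv (pchart c) y).2 + s *: x)
    = chart_inv (pchart c) (s *: row_mx 0 (cvec x) + y).
Proof.
rewrite /= linearD linearZ /= row_mxKl scaler0 add0r.
congr (_, _); rewrite linearD linearZ /= row_mxKr addrC.
rewrite -[in LHS](cvecK x) /= scaler_sumr -big_split /=.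
by apply: eq_bigr => k _; rewrite !mxE scalerDl scalerA.
Qed.

(** A chart of the phase space is affine along the fibers, so that both sides are
    limits of the same difference quotient. *)
Lemma fiber_fieldE c x F (y : 'rV[R]_(n + n)) :
  fiber_field x F (chart_inv (pchart c) y)
    = 'D_(row_mx 0 (cvec x)) (F \o chart_inv (pchart c)) y.
Proof.
rewrite /fiber_field derive1E [RHS]derive_lineE.
rewrite (_ : (fun s : R => F _) = fun s : R => (F \o chart_inv (pchart c))
  (s *: row_mx 0 (cvec x) + y)) //.
by apply/funext => s; rewrite phase_inv_line.
Qed.

Lemma smooth_fiber F x : smoothP F -> smoothP (fiber_field x F).
Proof.
move=> /smooth_phaseP sF; apply/smooth_phaseP => c Ac.
rewrite (_ : _ \o _ = 'D_(row_mx 0 (cvec x)) (F \o chart_inv (pchart c))).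
  exact: (smooth_on_derive (open_phase_codom Ac) _ (sF c Ac)).
by apply/funext => y; exact: fiber_fieldE.
Qed.

Lemma fiber_is_derive F x p : smoothP F ->
  is_derive (0 : R) (1 : R) (fun s : R => F (p.1, p.2 + s *: x)) (fiber_field x F p).
Proof.
move=> /smooth_phaseP sF; rewrite /fiber_field derive1E.
have [c [y [Ac cy ->]]] := phase_cover p.
have df := smooth_on_differentiable (open_phase_codom Ac) (sF c Ac) cy.
apply: derivableP.
have /derivable1P : derivable (F \o chart_inv (pchart c)) y (row_mx 0 (cvec x)).
  exact: diff_derivable.
rewrite (_ : (fun s : R => F _) = fun s : R => (F \o chart_inv (pchart c))
  (s *: row_mx 0 (cvec x) + y)) //.
by apply/funext => s; rewrite phase_inv_line.
Qed.

Lemma fiber_linear F p a x y : smoothP F ->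
  fiber_field (a *: x + y) F p = a * fiber_field x F p + fiber_field y F p.
Proof.
move=> /smooth_phaseP sF.
have [c [u [Ac cu ->]]] := phase_cover p.
have df := smooth_on_differentiable (open_phase_codom Ac) (sF c Ac) cu.
rewrite !fiber_fieldE !(deriveE _ df) cvec_linear.
have -> : row_mx 0 (a *: cvec x + cvec y)
    = a *: row_mx 0 (cvec x) + row_mx 0 (cvec y) :> 'rV[R]_(n + n).
  by rewrite scale_row_mx add_row_mx scaler0 addr0.
by rewrite linearP.
Qed.

Lemma fiber_comm F x y p : smoothP F ->
  fiber_field x (fiber_field y F) p = fiber_field y (fiber_field x F) p.
Proof.
move=> /smooth_phaseP sF.
have [c [u [Ac cu ->]]] := phase_cover p.
have E z : fiber_field z F \o chart_inv (pchart c)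
    = 'D_(row_mx 0 (cvec z)) (F \o chart_inv (pchart c)).
  by apply/funext => t; exact: fiber_fieldE.
rewrite (fiber_fieldE c x) (fiber_fieldE c y) !E.
exact: (derive_commute _ _ (open_phase_codom Ac) (sF c Ac) cu).
Qed.

Context (left_lv : forall x, left_invariant_field (lv x)).
Context (linear_lv : forall (a : R) x y f, smooth_fun (atlas G) f ->
  forall a', lv (a *: x + y) f a' = a * lv x f a' + lv y f a').

Lemma base_linear F p a x y : smoothP F ->
  base_field lv (a *: x + y) F p = a * base_field lv x F p + base_field lv y F p.
Proof. by move=> sF; rewrite /base_field linear_lv//; exact: smooth_phase_slice. Qed.

Lemma base_fieldE c x : atlas G c ->
  exists2 b : 'rV[R]_n -> 'rV[R]_n, smooth_map_on (chart_codom c) b &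
  forall F y, smoothP F -> chart_codom (pchart c) y ->
    base_field lv x F (chart_inv (pchart c) y)
    = \sum_i b (lsubmx y) 0 i *
        'D_(delta_mx 0 (lshift n i)) (F \o chart_inv (pchart c)) y.
Proof.
move=> Ac; have [b sb bE] := left_invariant_chart (left_lv x) Ac.
exists b => // F y sF /phase_codomE cy.
rewrite /base_field [chart_inv _ y]/= (bE _ _ (smooth_phase_slice _ sF) cy).
have -> : (fun a => F (a, (chart_inv (pchart c) y).2)) \o chart_inv c
    = fun u : 'rV[R]_n => (F \o chart_inv (pchart c)) (row_mx u (rsubmx y)).
  by apply/funext => u; rewrite /= row_mxKl row_mxKr.
rewrite derive_row_mx_l hsubmxK.
have df : differentiable (F \o chart_inv (pchart c)) y.
  move: sF => /smooth_phaseP /(_ c Ac) sF.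
  by apply: (smooth_on_differentiable (open_phase_codom Ac) sF); apply/phase_codomE.
rewrite (derive_lin _ df) big_split_ord /= [X in _ + X]big1 ?addr0 => [|k _].
  by apply: eq_bigr => i _; rewrite row_mxEl.
by rewrite row_mxEr mxE mul0r.
Qed.

Lemma smooth_base F x : smoothP F -> smoothP (base_field lv x F).
Proof.
move=> sF; apply/smooth_phaseP => c Ac.
have [b sb bE] := base_fieldE x Ac; have oU := open_phase_codom Ac.
apply: (@smooth_on_congr _ _ _ oU (fun y => \sum_i b (lsubmx y) 0 i *
        'D_(delta_mx 0 (lshift n i)) (F \o chart_inv (pchart c)) y)).
  by move=> y cy; rewrite -bE.
apply: (@smooth_on_sum _ _ _ oU) => i _; apply: (smooth_onM oU).
  apply: (smooth_on_comp oU (open_chart_codom (atlas_chart Ac))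
    (f := fun u => b u 0 i)) => //; last exact: smooth_lsubmx.
  by move=> y /phase_codomE.
by apply: smooth_on_partial; move: sF => /smooth_phaseP; apply.
Qed.

(** A left-invariant field acts on the group variable with coefficients that do
    not depend on the fiber variable; the rest is Schwarz's theorem. *)
Lemma fiber_base_comm F x y p : smoothP F ->
  fiber_field x (base_field lv y F) p = base_field lv y (fiber_field x F) p.
Proof.
move=> sF; have [c [u [Ac cu ->]]] := phase_cover p.
have [b sb bE] := base_fieldE y Ac; have oU := open_phase_codom Ac.
have sFc : smooth_on (chart_codom (pchart c)) (F \o chart_inv (pchart c)).
  by move: sF => /smooth_phaseP; apply.
set w := row_mx 0 (cvec x) : 'rV[R]_(n + n).
rewrite (bE _ _ (smooth_fiber _ sF) cu) fiber_fieldE -/w.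
have -> : fiber_field x F \o chart_inv (pchart c)
    = 'D_w (F \o chart_inv (pchart c)).
  by apply/funext => t; exact: fiber_fieldE.
transitivity ('D_w (\sum_(i < n) (fun t => b (lsubmx t) 0 i *
    'D_(delta_mx 0 (lshift n i)) (F \o chart_inv (pchart c)) t)) u).
  apply: near_eq_derive; apply: filterS (near_open oU cu) => t ct.
  by rewrite fct_sumE; exact: bE.
have db i : is_derive u w (fun t : 'rV[R]_(n + n) => b (lsubmx t) 0 i) 0.
  have bl : (fun h : R => b (lsubmx (h *: w + u)) 0 i) = cst (b (lsubmx u) 0 i).
    apply/funext => h; rewrite linearD linearZ /= /w row_mxKl scaler0 add0r.
    by [].
  split; first by apply/derivable1P; rewrite bl; exact: derivable_cst.
  by rewrite derive_lineE bl derive_cst.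
have dF i : differentiable ('D_(delta_mx 0 (lshift n i)) (F \o chart_inv (pchart c))) u.
  exact: (smooth_on_differentiable oU (smooth_on_partial _ sFc) cu).
rewrite derive_sum => [|i]; last first.
  apply: derivableM; first by have [] := db i.
  by apply: diff_derivable; exact: dF.
apply: eq_bigr => i _.
have dc := derive_commute w (delta_mx 0 (lshift n i)) oU sFc cu.
rewrite -[RHS](congr1 (fun a => b (lsubmx u) 0 i * a) dc).
exact: (deriveM_cst (db i) (diff_derivable (dF i))).
Qed.

End phase_space.

(** * Brackets with the drift *)

Lemma is_derive_quadratic (R : realType) (a b d : R) :
  is_derive (0 : R) (1 : R) (fun s : R => a + s * b + s ^+ 2 * d) b.
Proof.
have -> : (fun s : R => a + s * b + s ^+ 2 * d)
    = horner (a%:P + b *: 'X + d *: 'X^2).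
  apply/funext => s; rewrite !hornerE (mulrC s b) (mulrC (s ^+ 2)) expr2.
  by congr (_ + _); exact: mulrA.
apply: is_derive_eq.
by rewrite !derivD derivC !derivZ derivX derivXn add0r !hornerE.
Qed.

Section brackets.
Context (R : realType) (n : nat) (G : lieGroupType R n) (g : vectType R)
  (lv : g -> operator R G) (e : n.-tuple g) (Q : g -> g -> g) (nu : R).
Context (basis_e : basis_of fullv e).
Context (left_lv : forall x, left_invariant_field (lv x)).
Context (linear_lv : forall (a : R) x y f, smooth_fun (atlas G) f ->
  forall a', lv (a *: x + y) f a' = a * lv x f a' + lv y f a').
Context (QC : forall x y, Q x y = Q y x).
Context (QL : forall a x y z, Q (a *: x + y) z = a *: Q x z + Q y z).
Implicit Types (F H : G * g -> R) (x z v w : g) (p : G * g).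

Local Notation smoothP := (smooth_fun (phase_atlas G e)).
Local Notation drift := (@drift_field R n G g lv e Q nu).

Lemma scalar_coord (phi : g -> R) x :
  (forall a x y, phi (a *: x + y) = a * phi x + phi y) ->
  phi x = \sum_k coord e k x * phi e`_k.
Proof.
move=> lphi.
pose phiL : {linear g -> R^o} := HB.pack phi (GRing.isLinear.Build _ _ _ _ phi lphi).
rewrite -[LHS]/(phiL x) {1}(coord_basis basis_e (memvf x)) linear_sum.
by apply: eq_bigr => k _; rewrite linearZ.
Qed.

Lemma smooth_phase_scalar (phi : g -> R) :
  (forall a x y, phi (a *: x + y) = a * phi x + phi y) ->
  smoothP (fun p => phi p.2).
Proof.
move=> lphi; rewrite (_ : (fun p => _) =
  fun p : G * g => \sum_k coord e k p.2 * phi e`_k); last first.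
  by apply/funext => p; exact: scalar_coord.
apply: (smooth_phase_sum basis_e) => k _; apply: (smooth_phaseM basis_e);
  first exact: (smooth_phase_coord basis_e).
exact: smooth_phase_cst.
Qed.

Lemma coord_lin k a x y : coord e k (a *: x + y) = a * coord e k x + coord e k y.
Proof. by rewrite linearP. Qed.

Lemma coordQ_lin k z a x y :
  coord e k (Q (a *: x + y) z) = a * coord e k (Q x z) + coord e k (Q y z).
Proof. by rewrite QL linearP. Qed.

Lemma QE z v (s : R) :
  Q (z + s *: v) (z + s *: v) = Q z z + s *: (2 *: Q z v) + s ^+ 2 *: Q v v.
Proof.
rewrite addrC QL [Q v _]QC QL [Q z (_ + _)]QC QL (QC v z).
rewrite scalerDr scalerA -expr2 scalerA mulr2n mulrDr mulr1 scalerDl.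
by rewrite [RHS]addrC -!addrA; congr (_ + _); rewrite addrA addrC.
Qed.

Lemma is_derive_coord k z v :
  is_derive (0 : R) (1 : R) (fun s : R => coord e k (z + s *: v)) (coord e k v).
Proof.
rewrite (_ : (fun s => _) = fun s : R => coord e k z + s * coord e k v + s ^+ 2 * 0).
  exact: is_derive_quadratic.
by apply/funext => s; rewrite mulr0 addr0 addrC coord_lin addrC.
Qed.

Lemma is_derive_coordQ k z v : is_derive (0 : R) (1 : R)
  (fun s : R => coord e k (Q (z + s *: v) (z + s *: v))) (2 * coord e k (Q z v)).
Proof.
rewrite (_ : (fun s => _) = fun s : R => coord e k (Q z z)
    + s * (2 * coord e k (Q z v)) + s ^+ 2 * coord e k (Q v v)).
  exact: is_derive_quadratic.
by apply/funext => s; rewrite QE !linearD !linearZ.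
Qed.

Lemma smooth_phaseQ k : smoothP (fun p => coord e k (Q p.2 p.2)).
Proof.
rewrite (_ : (fun p => _) =
    fun p : G * g => \sum_i coord e i p.2 * coord e k (Q p.2 e`_i)); last first.
  apply/funext => p; rewrite (@scalar_coord (fun x => coord e k (Q x p.2))); last first.
    by move=> a x y; exact: coordQ_lin.
  by apply: eq_bigr => i _; rewrite QC.
apply: (smooth_phase_sum basis_e) => i _; apply: (smooth_phaseM basis_e);
  first exact: (smooth_phase_coord basis_e).
by apply: (@smooth_phase_scalar (fun x => coord e k (Q x e`_i))) => a x y; exact: coordQ_lin.
Qed.

Lemma fiber_sum F p x : smoothP F ->
  fiber_field x F p = \sum_k coord e k x * fiber_field e`_k F p.
Proof.
move=> sF; apply: (@scalar_coord (fun x => fiber_field x F p)) => a u v.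
exact: (fiber_linear basis_e).
Qed.

Lemma base_sum F p x : smoothP F ->
  base_field lv x F p = \sum_k coord e k x * base_field lv e`_k F p.
Proof.
move=> sF; apply: (@scalar_coord (fun x => base_field lv x F p)) => a u v.
exact: (base_linear basis_e linear_lv).
Qed.

Lemma smooth_drift F : smoothP F -> smoothP (drift F).
Proof.
move=> sF; apply: (smooth_phaseD basis_e); apply: (smooth_phase_sum basis_e) => k _.
  apply: (smooth_phaseM basis_e);
  first exact: (smooth_phase_coord basis_e).
  exact: (smooth_base basis_e left_lv).
apply: (smooth_phaseM basis_e); last exact: (smooth_fiber basis_e).
apply: (smooth_phaseD basis_e); first exact: smooth_phaseQ.
rewrite (_ : (fun p => _) = fun p : G * g => - nu * coord e k p.2); last first.
  by apply/funext => p; rewrite mulNr.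
by apply: (smooth_phaseM basis_e); [exact: smooth_phase_cst|exact: (smooth_phase_coord basis_e)].
Qed.

Lemma fiber_val F v p (d : R) :
  is_derive (0 : R) (1 : R) (fun s : R => F (p.1, p.2 + s *: v)) d ->
  fiber_field v F p = d.
Proof. by move=> [_ <-]; rewrite /fiber_field derive1E. Qed.

(** The Leibniz rule on the coefficients of the drift: the derivative of [z^k]
    along [v] contributes the left-invariant field of [v], that of
    [q(z, z) - nu z] contributes [2 q(z, v) - nu v], and the remaining terms are
    the drift of the derivative because the derivatives commute. *)
Lemma fiber_drift F v p : smoothP F ->
  fiber_field v (drift F) p = drift (fiber_field v F) p
    + (base_field lv v F p + fiber_field (2 *: Q p.2 v - nu *: v) F p).
Proof.
move=> sF.
have dB k := fiber_is_derive basis_e v p (smooth_base basis_e left_lv e`_k sF).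
have dF k := fiber_is_derive basis_e v p (smooth_fiber basis_e e`_k sF).
have dz k := is_derive_coord k p.2 v.
have dq k := is_derive_coordQ k p.2 v.
have dQ k := is_deriveB (dq k) (is_deriveZ nu (dz k)).
have := is_deriveD (is_derive_sum (fun k => is_deriveM (dz k) (dB k)))
                   (is_derive_sum (fun k => is_deriveM (dQ k) (dF k))).
rewrite (_ : _ + _ = fun s : R => drift F (p.1, p.2 + s *: v)); last first.
  by apply/funext => s; rewrite fctE !fct_sumE.
move=> /fiber_val ->.
rewrite !scale0r !addr0 -!surjective_pairing !big_split /= addrACA.
rewrite (base_sum _ _ sF) (fiber_sum _ _ sF) /drift_field.
have addE := f_equal2 (fun a b : R => a + b).
apply: (addE _ _ _ _ (addE _ _ _ _ _ _) (addE _ _ _ _ _ _)); apply: eq_bigr => k _.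
- exact: (congr1 (fun a => _ * a) (fiber_base_comm basis_e left_lv _ _ _ sF)).
- have -> : ((fun s : R => coord e k (Q (p.2 + s *: v) (p.2 + s *: v)))
      - nu \*: (fun s : R => coord e k (p.2 + s *: v))) 0
      = coord e k (Q p.2 p.2) - nu * coord e k p.2.
    rewrite -[LHS]/(coord e k (Q (p.2 + 0 *: v) (p.2 + 0 *: v))
      - nu * coord e k (p.2 + 0 *: v)).
    by rewrite scale0r addr0.
  exact: (congr1 (fun a => _ * a) (fiber_comm basis_e _ _ _ sF)).
- by rewrite mulrC.
- have -> : coord e k (2 *: Q p.2 v - nu *: v)
      = 2 * coord e k (Q p.2 v) - nu *: coord e k v by rewrite linearB !linearZ.
  exact: mulrC.
Qed.

Lemma drift_fiber_commutator F v p : smoothP F ->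
  commutator drift (fiber_field v) F p
  = - (base_field lv v F p + fiber_field (2 *: Q p.2 v - nu *: v) F p).
Proof. by move=> sF; rewrite /commutator fiber_drift// opprD addNKr. Qed.

(** Brackets of the drift with two constant vertical fields produce the constant
    vertical field in the direction of the quadratic form: differentiating the
    quadratic drift twice leaves its polarization. *)
Lemma bracket_fiber (Y Z : operator R (G * g)) v w F p :
  (forall F, smoothP F -> Y F = fiber_field v F) ->
  (forall F, smoothP F -> Z F = fiber_field w F) -> smoothP F ->
  commutator (commutator drift Y) Z F p = fiber_field (2 *: Q v w) F p.
Proof.
move=> YE ZE sF.
(* [[X0, d_v]] with its vertical direction expanded in the basis: in this form
   the operator is visibly smooth and can be differentiated again *)
pose W F p := - (base_field lv v F p
  + \sum_k (2 * coord e k (Q p.2 v) - nu * coord e k v) * fiber_field e`_k F p).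
have WE H : smoothP H -> commutator drift Y H = W H.
  move=> sH; apply/funext => r.
  transitivity (commutator drift (fiber_field v) H r).
    by rewrite /commutator (YE _ sH) (YE _ (smooth_drift sH)).
  rewrite drift_fiber_commutator// (fiber_sum _ (_ - _) sH) /W.
  by congr (- (_ + _)); apply: eq_bigr => k _; rewrite linearB !linearZ.
have sW : smoothP (W F).
  rewrite /W (_ : (fun p => _) = fun p => -1 * (base_field lv v F p
    + \sum_k (2 * coord e k (Q p.2 v) - nu * coord e k v) * fiber_field e`_k F p)).
    apply: (smooth_phaseM basis_e); first exact: smooth_phase_cst.
    apply: (smooth_phaseD basis_e); first exact: (smooth_base basis_e left_lv).
    apply: (smooth_phase_sum basis_e) => k _.
    apply: (smooth_phaseM basis_e); last exact: (smooth_fiber basis_e).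
    apply: (smooth_phaseD basis_e); last exact: smooth_phase_cst.
    apply: (smooth_phaseM basis_e); first exact: smooth_phase_cst.
    by apply: (@smooth_phase_scalar (fun x => coord e k (Q x v))) => a x y; exact: coordQ_lin.
  by apply/funext => r; rewrite mulN1r.
transitivity (commutator drift Y (Z F) p - Z (commutator drift Y F) p); first by [].
rewrite (ZE _ sF) (WE _ sF) (ZE _ sW) (WE _ (smooth_fiber basis_e w sF)).
have dB := fiber_is_derive basis_e w p (smooth_base basis_e left_lv v sF).
have dF k := fiber_is_derive basis_e w p (smooth_fiber basis_e e`_k sF).
have dc k : is_derive (0 : R) (1 : R)
    (fun s : R => 2 * coord e k (Q (p.2 + s *: w) v) - nu * coord e k v)
    (2 * coord e k (Q w v)).
  rewrite (_ : (fun s => _) = fun s : R => (2 * coord e k (Q p.2 v)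
      - nu * coord e k v) + s * (2 * coord e k (Q w v)) + s ^+ 2 * 0).
    exact: is_derive_quadratic.
  apply/funext => s; rewrite mulr0 addr0 [p.2 + _]addrC coordQ_lin mulrDr.
  by rewrite -addrA [RHS]addrC [2 * (s * _)]mulrCA.
have := is_deriveN (is_deriveD dB (is_derive_sum (fun k => is_deriveM (dc k) (dF k)))).
rewrite (_ : - _ = fun s : R => W F (p.1, p.2 + s *: w)); last first.
  by apply/funext => s; rewrite fctE fct_sumE.
move=> /fiber_val ->; rewrite !scale0r !addr0 -!surjective_pairing big_split /=.
rewrite /W (fiber_base_comm basis_e left_lv _ _ _ sF).
have cancel (a b b' d d' : R) : b' = b -> d = d' -> - (a + b) - - (a + (b' + d)) = d'.
  by move=> -> ->; rewrite opprK [a + (b + _)]addrA addKr.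
apply: cancel; last rewrite (fiber_sum _ (2 *: _) sF); apply: eq_bigr => k _.
  exact: (congr1 (fun a => _ * a) (fiber_comm basis_e _ _ _ sF)).
have -> : coord e k (2 *: Q v w) = 2 * coord e k (Q w v) by rewrite linearZ QC.
exact: mulrC.
Qed.

End brackets.

(** * Linear algebra *)

(** Take a subspace of maximal dimension among those contained in [P]: adding to
    it the line of any further element of [P] would increase the dimension. *)
Lemma vspace_of_pred (K : fieldType) (V : vectType K) (P : V -> Prop) :
  P 0 -> (forall a x y, P x -> P y -> P (a *: x + y)) ->
  exists M : {vspace V}, forall x, x \in M <-> P x.
Proof.
move=> P0 Plin.
pose D d := `[< exists2 M : {vspace V}, \dim M = d & forall x, x \in M -> P x >].
have D0 : exists d, D d.
  by exists 0; apply/asboolP; exists 0%VS; rewrite ?dimv0// => x /[!memv0]/eqP->.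
have Dmax d : D d -> (d <= \dim (@fullv K V))%N.
  by move=> /asboolP[M <- _]; exact/dimvS/subvf.
case: (ex_maxnP D0 Dmax) => d /asboolP[M dM MP] maxd.
exists M => x; split; first exact: MP.
move=> Px; have [|xM] := boolP (x \in M); first by [].
have : D (\dim (M + <[x]>)).
  apply/asboolP; exists (M + <[x]>)%VS => // _ /memv_addP[u uM [_ /vlineP[a ->] ->]].
  by rewrite addrC; apply: Plin => //; exact: MP.
move=> /maxd; rewrite -dM => dle.
have : (M + <[x]> <= M)%VS.
  have /eqP <- : M == (M + <[x]>)%VS by rewrite eqEdim addvSl dle.
  exact: subvv.
move=> /subvP/(_ x); rewrite (negbTE xM) => /(_ _)/negP[]//.
exact: (subvP (addvSr M <[x]>%VS)) (memv_line x).
Qed.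

Lemma gram_eq0 (R : realFieldType) m p (N : 'M[R]_(m, p)) : N^T *m N = 0 -> N = 0.
Proof.
move=> N0; apply/matrixP => i j; rewrite mxE.
have : (N^T *m N) j j = 0 by rewrite N0 mxE.
rewrite mxE => /eqP; rewrite psumr_eq0 => [/allP/(_ i)|k _]; last first.
  by rewrite mxE -expr2 sqr_ge0.
by rewrite mem_index_enum mxE -expr2 sqrf_eq0 => /(_ isT)/eqP.
Qed.

(** A linear form that kills the range of [s *m s^T] also kills the range of [s],
    by [gram_eq0]; hence the two ranges are equal. *)
Lemma range_gram (R : realFieldType) m p (s : 'M[R]_(m, p)) :
  exists D, s = (s *m s^T) *m D.
Proof.
have : (s^T <= s *m s^T)%MS.
  rewrite submxE; apply/eqP/gram_eq0.
  by rewrite trmx_mul trmxK mulmxA -(mulmxA _ s) -mulmxA mulmx_coker mulmx0.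
case/submxP => D sD; exists D^T.
by move: sD => /(congr1 trmx); rewrite trmxK !trmx_mul trmxK.
Qed.

(** * The smallest algebra of the bracket condition *)

Section hormander_algebra_theory.
Context (R : realType) (r : nat) (T : Type) (X0 : operator R T)
  (X : 'I_r -> operator R T).
Local Notation L := (hormander_algebra X0 X).

Lemma hormander_gen j : L (X j).
Proof. by move=> S [_ XS]; apply: XS; exists j. Qed.

Lemma hormander_lin a Y Z : L Y -> L Z -> L (fun f p => a * Y f p + Z f p).
Proof.
move=> LY LZ S HS; have [[[_ lin _] _] _] := HS.
by apply: lin; [exact: LY|exact: LZ].
Qed.

Lemma hormander0 : L (fun _ _ => 0).
Proof. by move=> S [[[]]]. Qed.

Lemma hormander_commutator Y Z : L Y -> L Z -> L (commutator Y Z).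
Proof.
move=> LY LZ S HS; have [[[_ _ com] _] _] := HS.
by apply: com; [exact: LY|exact: LZ].
Qed.

Lemma hormander_drift Y : L Y -> L (commutator X0 Y).
Proof.
by move=> LY S HS; have [[_ com] _] := HS; apply: com; exact: LY.
Qed.

Lemma hormander_ind (S : set (operator R T)) : lie_subalgebra S ->
  (forall Y, S Y -> S (commutator X0 Y)) -> (forall j, S (X j)) -> L `<=` S.
Proof.
move=> HS com HX; apply: smallest_sub; first by split.
by move=> _ [j _ <-].
Qed.

End hormander_algebra_theory.

(** * The Fokker-Planck operator as a sum of squares *)

Section fokker_planck_operator.
Context (R : realType) (n : nat) (G : lieGroupType R n) (g : vectType R)
  (lv : g -> operator R G) (e : n.-tuple g) (Q : g -> g -> g) (nu : R).
Context (basis_e : basis_of fullv e).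
Context (left_lv : forall x, left_invariant_field (lv x)).
Context (linear_lv : forall (a : R) x y f, smooth_fun (atlas G) f ->
  forall a', lv (a *: x + y) f a' = a * lv x f a' + lv y f a').
Context (QC : forall x y, Q x y = Q y x).
Context (QL : forall a x y z, Q (a *: x + y) z = a *: Q x z + Q y z).
Implicit Types (F H : G * g -> R) (x z v w : g) (p : G * g).

Local Notation smoothP := (smooth_fun (phase_atlas G e)).
Local Notation drift := (@drift_field R n G g lv e Q nu).
Local Notation cvec := (chart_map (coord_chart e)).
Local Notation vec := (chart_inv (coord_chart e)).
Local Notation pchart c := (prod_chart c (coord_chart e)).

Lemma smooth_time_slice (f : R * (G * g) -> R) (t : R) :
  smooth_fun (time_atlas (phase_atlas G e)) f ->
  smoothP (fun p => f (t, p)).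
Proof.
move=> sf; apply/smooth_phaseP => c Ac.
have oc := open_phase_codom basis_e Ac.
have sfc := sf (prod_chart (line_chart R) (pchart c)).
pose T1 : 'rV[R]_1 := \row_(_ < 1) t.
have oE : open ((fun y : 'rV[R]_(1 + (n + n)) => rsubmx y) @^-1` chart_codom (pchart c)).
  by apply: open_preimage_smooth => //; exact: smooth_rsubmx.
apply: (@smooth_on_congr _ _ _ oc
  ((f \o chart_inv (prod_chart (line_chart R) (pchart c))) \o
    (fun y : 'rV[R]_(n + n) => row_mx T1 y))).
  by move=> y _; rewrite /= row_mxKl row_mxKr mxE.
apply: (smooth_on_comp oc oE).
- by move=> y cy; rewrite /= row_mxKr.
- exact: smooth_row_mx_r.
apply: smooth_onS (sfc _).
  move=> y cy; apply/prod_chart_codomE; split=> //.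
  by exists (lsubmx y 0 0) => //; apply/rowP => i; rewrite !ord1 mxE.
exists (line_chart R), (pchart c); split=> //.
by exists c, (coord_chart e).
Qed.

Lemma fiber_lincomb I (s : seq I) x (a : I -> R) (H : I -> G * g -> R) p :
  (forall i, smoothP (H i)) ->
  fiber_field x (fun p => \sum_(i <- s) a i * H i p) p
  = \sum_(i <- s) a i * fiber_field x (H i) p.
Proof.
move=> sH; apply: fiber_val.
elim: s => [|i s IH].
  rewrite big_nil (_ : (fun s => _) = cst 0); first exact: is_derive_cst.
  by apply/funext => t; rewrite big_nil.
rewrite big_cons (_ : (fun s => _) = (a i *: (fun t : R => H i (p.1, p.2 + t *: x)) : R -> R)
   + (fun t : R => \sum_(i <- s) a i * H i (p.1, p.2 + t *: x))).
  apply: is_deriveD.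
  exact: is_deriveZ (fiber_is_derive basis_e x p (sH i)).
by apply/funext => t; rewrite big_cons.
Qed.

Lemma diffusion_fieldE r (sigma : 'M[R]_(n, r)) j F : smoothP F ->
  diffusion_field G e sigma j F = fiber_field (\sum_k sigma k j *: e`_k) F.
Proof.
move=> sF; apply/funext => p; rewrite (fiber_sum basis_e p _ sF).
apply: eq_bigr => k _; rewrite coord_sum_free//; exact: basis_free basis_e.
Qed.

(** Expanding [d_k (nu z^k F)] by the Leibniz rule gives the damping part of the
    drift and, summed over [k], the zeroth order term [- n nu F]; and
    [h = sigma sigma^T] turns the second order part into the sum of the squares
    of the diffusion fields. *)
Lemma sum_of_squares r (h : 'M[R]_n) (sigma : 'M[R]_(n, r)) (eps : R) :
  0 < eps -> h = sigma *m sigma^T ->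
  sum_of_squares_form (phase_atlas G e) (fokker_planck lv e Q nu eps h)
    drift (diffusion_field G e sigma).
Proof.
move=> eps0 hE; exists (eps ^+ 2 / 2), (- (nu * n%:R)).
split=> [|f sf [t p] F]; first by rewrite divr_gt0 ?exprn_gt0.
have sF : smoothP F := smooth_time_slice t sf.
rewrite /fokker_planck -/F /= /drift_field.
have sf1 k := smooth_fiber basis_e e`_k sF.
pose S := \sum_k \sum_l h k l * fiber_field e`_k (fiber_field e`_l F) p.
pose D := \sum_k nu * coord e k p.2 * fiber_field e`_k F p.
have E1 (k : 'I_n) : fiber_field e`_k (fun p' => - (nu * coord e k p'.2 * F p')
      - eps ^+ 2 / 2 * \sum_(l < n) h k l * fiber_field e`_l F p') p
    = - (nu * F p) - nu * coord e k p.2 * fiber_field e`_k F p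
      - eps ^+ 2 / 2 * \sum_(l < n) h k l * fiber_field e`_k (fiber_field e`_l F) p.
  have sS : smoothP (fun p' => \sum_(l < n) h k l * fiber_field e`_l F p').
    apply: (smooth_phase_sum basis_e) => l _.
    by apply: (smooth_phaseM basis_e); [exact: smooth_phase_cst|exact: sf1].
  have ckk : coord e k e`_k = 1.
    by rewrite coord_free ?eqxx// (basis_free basis_e).
  have dc := is_derive_coord e k p.2 e`_k; rewrite ckk in dc.
  have d1 := is_deriveM (is_deriveZ nu dc) (fiber_is_derive basis_e e`_k p sF).
  have d2 := fiber_is_derive basis_e e`_k p sS.
  rewrite (@fiber_lincomb _ _ _ _ _ _ (fun l : 'I_n => sf1 l)) in d2.
  have d := is_deriveB (is_deriveN d1) (is_deriveZ (eps ^+ 2 / 2) d2).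
  apply: (etrans (fiber_val (F := fun p' => - (nu * coord e k p'.2 * F p')
      - eps ^+ 2 / 2 * \sum_(l < n) h k l * fiber_field e`_l F p') d)).
  rewrite -[X in - (X + _)]/(nu * coord e k (p.2 + 0 *: e`_k) * fiber_field e`_k F p).
  rewrite scale0r addr0 -surjective_pairing [nu *: 1]mulr1 [F p *: nu]mulrC.
  by rewrite opprD [- _ - nu * F p]addrC.
have E2 : \sum_(j < r) diffusion_field G e sigma j (diffusion_field G e sigma j F) p = S.
  have Ej (j : 'I_r) : diffusion_field G e sigma j (diffusion_field G e sigma j F) p
    = \sum_k \sum_l sigma k j * (sigma l j * fiber_field e`_k (fiber_field e`_l F) p).
    apply: eq_bigr => k _; rewrite -mulr_sumr; congr (_ * _).
    exact: (@fiber_lincomb _ _ _ _ _ _ (fun l : 'I_n => sf1 l)).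
  rewrite (eq_bigr _ (fun j _ => Ej j)) exchange_big /=; apply: eq_bigr => k _.
  rewrite exchange_big /=; apply: eq_bigr => l _.
  rewrite hE mxE mulr_suml; apply: eq_bigr => j _.
  by rewrite mxE mulrA.
have E3 : \sum_(k < n) fiber_field e`_k (fun p' => - (nu * coord e k p'.2 * F p')
      - eps ^+ 2 / 2 * \sum_(l < n) h k l * fiber_field e`_l F p') p
    = - (nu * n%:R) * F p - D - eps ^+ 2 / 2 * S.
  rewrite (eq_bigr _ (fun k _ => E1 k)) !big_split /= !sumrN -[X in _ - X = _]mulr_sumr.
  have -> : \sum_(k < n) nu * F p = nu * n%:R * F p.
    by rewrite sumr_const card_ord -[LHS]mulr_natr mulrAC.
  by rewrite mulNr.
have E4 : \sum_(k < n) (coord e k (Q p.2 p.2) - nu * coord e k p.2)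
      * fiber_field e`_k F p
    = \sum_(k < n) coord e k (Q p.2 p.2) * fiber_field e`_k F p - D.
  by rewrite -sumrB; apply: eq_bigr => k _; rewrite mulrBl.
rewrite E2 E3 E4.
have alg (a b d x y z : R) : a + b + d + (x - y - z) = a + (b + (d - y)) - z + x.
  by ring.
exact: alg.
Qed.
End fokker_planck_operator.

(** * The bracket condition *)

Section bracket_condition.
Context (R : realType) (n : nat) (G : lieGroupType R n) (g : vectType R)
  (lv : g -> operator R G) (e : n.-tuple g) (Q : g -> g -> g) (nu : R).
Context (basis_e : basis_of fullv e).
Context (left_lv : forall x, left_invariant_field (lv x)).
Context (linear_lv : forall (a : R) x y f, smooth_fun (atlas G) f ->
  forall a', lv (a *: x + y) f a' = a * lv x f a' + lv y f a').
Context (inj_lv : forall x y,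
  (forall f, smooth_fun (atlas G) f -> lv x f =1 lv y f) -> x = y).
Context (QC : forall x y, Q x y = Q y x).
Context (QL : forall a x y z, Q (a *: x + y) z = a *: Q x z + Q y z).
Implicit Types (F H : G * g -> R) (x z v w : g) (p : G * g).

Local Notation smoothP := (smooth_fun (phase_atlas G e)).
Local Notation drift := (@drift_field R n G g lv e Q nu).
Local Notation cvec := (chart_map (coord_chart e)).
Local Notation vec := (chart_inv (coord_chart e)).
Local Notation pchart c := (prod_chart c (coord_chart e)).

Lemma left_zero f a : smooth_fun (atlas G) f -> lv 0 f a = 0.
Proof.
move=> sf; have := linear_lv (-1) 0 0 sf a.
by rewrite scaler0 addr0 mulN1r addNr.
Qed.

(** Evaluation at a point maps the left-invariant fields injectively, because a
    left-invariant field that vanishes at one point vanishes everywhere, hence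
    bijectively, because both dimensions are [n]. *)
Lemma left_invariant_span c (u : 'rV[R]_n) (w : 'rV[R]_n) : atlas G c -> chart_codom c u ->
  exists x, forall f, smooth_fun (atlas G) f ->
    'D_w (f \o chart_inv c) u = lv x f (chart_inv c u).
Proof.
move=> Ac cu.
have bP (k : 'I_n) : exists b : 'rV[R]_n, forall f, smooth_fun (atlas G) f ->
    lv e`_k f (chart_inv c u) = 'D_b (f \o chart_inv c) u.
  have [b _ bE] := left_invariant_chart (left_lv e`_k) Ac.
  by exists (b u) => f sf; exact: bE.
have [b bE] := choice bP.
(* [B] is the matrix of the evaluation map in the basis [e] and the chart [c] *)
pose B := \matrix_k b k.
have lvE (t : 'rV[R]_n) f : smooth_fun (atlas G) f ->
    lv (vec t) f (chart_inv c u) = 'D_(t *m B) (f \o chart_inv c) u.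
  move=> sf.
  have df : differentiable (f \o chart_inv c) u.
    exact: (smooth_on_differentiable (open_chart_codom (atlas_chart Ac)) (sf _ Ac) cu).
  rewrite (@scalar_coord _ _ _ _ basis_e (fun x => lv x f (chart_inv c u))); last first.
    by move=> a x y; exact: linear_lv.
  rewrite (deriveE _ df) mulmx_sum_row linear_sum; apply: eq_bigr => k _.
  rewrite coord_sum_free; last exact: basis_free basis_e.
  rewrite linearZ -(deriveE _ df) rowK.
  exact: (congr1 (fun d => t 0 k * d) (bE k f sf)).
have freeB : row_free B.
  rewrite -kermx_eq0; apply/eqP/row_matrixP => i; rewrite row0.
  set t := row i _.
  have tB : t *m B = 0 by rewrite -row_mul mulmx_ker row0.
  have t0 : vec t = 0.
    apply: inj_lv => f sf a'; rewrite left_zero//.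
    have [_ inv] := left_lv (vec t).
    rewrite -[a'](mulgVK (chart_inv c u)) -(inv _ _ sf) lvE; last exact: smooth_translate.
    by rewrite tB derive0.
  by rewrite -(vecK basis_e t) t0; apply/rowP => k; rewrite !mxE linear0.
exists (vec (w *m invmx B)) => f sf.
by rewrite lvE// mulmxKV// -row_free_unit.
Qed.

Lemma phase_tangent p (v : (G * g -> R) -> R) : tangent_vector (phase_atlas G e) p v ->
  exists x y, forall F, smoothP F -> v F = base_field lv x F p + fiber_field y F p.
Proof.
move=> [_ [w [[c [d [Ac -> ->]]] [/= cp _] vE]]].
have cu := chart_codom_map cp.
have [x xE] := left_invariant_span (lsubmx w) Ac cu.
exists x, (vec (rsubmx w)) => F sF; rewrite vE//.
set u := row_mx (chart_map c p.1) (cvec p.2).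
have ip : chart_inv (pchart c) u = p by exact: phase_inv_map.
have df : differentiable (F \o chart_inv (pchart c)) u.
  move: (sF) => /smooth_phaseP /(_ c Ac) sFc.
  apply: (smooth_on_differentiable (open_phase_codom basis_e Ac) sFc).
  by apply/(phase_codomE basis_e); rewrite row_mxKl.
transitivity ('D_(row_mx (lsubmx w) 0) (F \o chart_inv (pchart c)) u
   + 'D_(row_mx 0 (rsubmx w)) (F \o chart_inv (pchart c)) u).
  rewrite !(deriveE _ df) -linearD add_row_mx addr0 add0r hsubmxK.
  by [].
congr (_ + _).
  rewrite /base_field -[X in lv x _ X](chart_mapK (atlas_chart Ac) cp).
  rewrite -xE; last exact: (smooth_phase_slice basis_e).
  rewrite -derive_row_mx_l.
  have -> : (fun a => F (a, p.2)) \o chart_inv c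
    = fun u : 'rV[R]_n => (F \o chart_inv (pchart c)) (row_mx u (cvec p.2)).
    apply/funext => t; rewrite /= row_mxKl row_mxKr.
    by rewrite -[in LHS](cvecK basis_e p.2).
  by [].
rewrite -[in RHS]ip (fiber_fieldE basis_e c).
by rewrite vecK.
Qed.

Context (r : nat) (sigma : 'M[R]_(n, r)).
Local Notation X := (diffusion_field G e sigma).
Local Notation L := (hormander_algebra drift X).
Local Notation col_vec j := (\sum_k sigma k j *: e`_k).

(** The directions of the constant vertical fields of the algebra are a linear
    subspace, stable under the quadratic form by the double bracket. *)
Lemma vertical_directions :
  (forall M : {vspace g}, (forall j, col_vec j \in M) ->
     (forall z z', z \in M -> z' \in M -> Q z z' \in M) -> M = fullv) ->
  forall x, exists2 Y, L Y & forall F, smoothP F -> Y F = fiber_field x F.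
Proof.
move=> full.
have [||M MP] := @vspace_of_pred _ g
  (fun x => exists2 Y, L Y & forall F, smoothP F -> Y F = fiber_field x F).
- exists (fun _ _ => 0); first exact: hormander0.
  move=> F sF; apply/funext => p.
  by have := fiber_linear basis_e p (-1) 0 0 sF; rewrite scaler0 addr0 mulN1r addNr.
- move=> a x y [Y LY YE] [Z LZ ZE]; exists (fun f p => a * Y f p + Z f p).
    exact: hormander_lin.
  move=> F sF; apply/funext => p.
  by rewrite (fiber_linear basis_e p a x y sF) YE// ZE.
move=> x; apply/MP; suff -> : M = fullv by exact: memvf.
apply: full => [j|z z' /MP[Y LY YE] /MP[Z LZ ZE]].
  apply/MP; exists (X j); first exact: hormander_gen.
  by move=> F sF; exact: diffusion_fieldE.
have : 2 *: Q z z' \in M.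
  apply/MP; exists (commutator (commutator drift Y) Z).
    by apply: hormander_commutator => //; exact: hormander_drift.
  move=> F sF; apply/funext => p.
  exact: (@bracket_fiber _ _ _ _ lv e Q nu basis_e left_lv linear_lv QC QL _ _ _ _ _ p YE ZE sF).
by move=> /(memvZ 2^-1); rewrite scalerA mulVf ?scale1r.
Qed.

(** The left-invariant part of a tangent vector is provided by [[X0, d_x]], whose
    vertical part at the given point is corrected by a constant vertical field. *)
Lemma nondegenerate_spans :
  (forall M : {vspace g}, (forall j, col_vec j \in M) ->
     (forall z z', z \in M -> z' \in M -> Q z z' \in M) -> M = fullv) ->
  forall p (v : (G * g -> R) -> R), tangent_vector (phase_atlas G e) p v ->
    exists2 Y, L Y & forall F, smoothP F -> v F = Y F p.
Proof.
move=> /vertical_directions vert p v /phase_tangent[x [y vE]].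
have [Y LY YE] := vert x.
have [Z LZ ZE] := vert (-1 *: (2 *: Q p.2 x - nu *: x) + y).
exists (fun f p => -1 * commutator drift Y f p + Z f p).
  by apply: hormander_lin => //; exact: hormander_drift.
move=> F sF; rewrite vE// ZE//.
have -> : commutator drift Y F p = commutator drift (fiber_field x) F p.
  have sd : smoothP (drift F) by exact: smooth_drift.
  by rewrite /commutator (YE _ sF) (YE _ sd).
rewrite (@drift_fiber_commutator _ _ _ _ lv e Q nu basis_e left_lv linear_lv QC QL _ _ p sF).
rewrite mulN1r opprK -addrA; congr (_ + _).
by rewrite (fiber_linear basis_e p (-1) _ y sF) mulN1r addNKr.
Qed.

(** The drift and the diffusion fields are tangent to [G * M], and tangent fields
    form a Lie algebra.  Tangency is expressed algebraically: the field preserves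
    the ideal of the smooth functions that vanish on [G * M], a property that
    brackets inherit. *)
Lemma hormander_tangent (M : {vspace g}) :
  (forall j, col_vec j \in M) ->
  (forall z z', z \in M -> z' \in M -> Q z z' \in M) ->
  forall Y F, L Y -> smoothP F -> (forall p, p.2 \in M -> F p = 0) ->
  forall p, p.2 \in M -> Y F p = 0.
Proof.
move=> sM QM.
pose I F := smoothP F /\ forall p, p.2 \in M -> F p = 0.
pose S : set (operator R (G * g)) := [set Y | forall F, I F -> I (Y F)].
have fiberI x F : I F -> forall p, p.2 \in M -> x \in M -> fiber_field x F p = 0.
  move=> [sF F0] p pM xM; apply: fiber_val.
  rewrite (_ : (fun s => _) = cst 0); first exact: is_derive_cst.
  by apply/funext => t; rewrite F0//= memvD// memvZ.
have baseI x F : I F -> forall p, p.2 \in M -> base_field lv x F p = 0.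
  move=> [sF F0] p pM; rewrite /base_field.
  rewrite (_ : (fun a => _) = cst 0); last by apply/funext => a; exact: F0.
  have [[tX _] _] := left_lv x; have [c [w [Ac _ ->]]] := tX p.1.
    by rewrite (_ : _ \o _ = cst 0) ?derive_cst.
  by move=> d Ad; exact: smooth_on_cst.
have driftS : S drift.
  move=> F IF; have [sF F0] := IF; split=> [|p pM]; first exact: smooth_drift.
  rewrite /drift_field big1 => [|k _]; last by rewrite baseI ?mulr0.
  rewrite add0r -[RHS](fiberI (Q p.2 p.2 - nu *: p.2) F IF p pM); last first.
    by rewrite memvB ?memvZ ?QM.
  rewrite (fiber_sum basis_e _ _ sF); apply: eq_bigr => k _.
  have -> : coord e k (Q p.2 p.2 - nu *: p.2)
    = coord e k (Q p.2 p.2) - nu *: coord e k p.2 by rewrite linearB linearZ.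
  by [].
have linS a Y Z : S Y -> S Z -> S (fun f p => a * Y f p + Z f p).
  move=> SY SZ F IF; have [sY Y0] := SY F IF; have [sZ Z0] := SZ F IF.
  split=> [|p pM]; last by rewrite Y0// Z0// mulr0 addr0.
  exact: (smooth_phaseD basis_e (smooth_phaseM basis_e (smooth_phase_cst a) sY) sZ).
have comS Y Z : S Y -> S Z -> S (commutator Y Z).
  move=> SY SZ F IF.
  have [sYZ YZ0] := SY _ (SZ F IF); have [sZY ZY0] := SZ _ (SY F IF).
  split=> [|p pM]; last by rewrite /commutator YZ0// ZY0// subr0.
  rewrite (_ : commutator Y Z F = fun p => Y (Z F) p + -1 * Z (Y F) p); last first.
    by apply/funext => p; rewrite mulN1r.
  exact: (smooth_phaseD basis_e sYZ
    (smooth_phaseM basis_e (smooth_phase_cst (-1)) sZY)).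
have LS : L `<=` S.
  apply: hormander_ind.
  - split=> //; by move=> F IF; split=> // c Ac; exact: smooth_on_cst.
  - by move=> Y SY; exact: comS.
  - move=> j F IF; have [sF F0] := IF; rewrite (diffusion_fieldE basis_e sigma j sF).
    split=> [|p pM]; first exact: (smooth_fiber basis_e).
    exact: fiberI.
by move=> Y F LY sF F0 p pM; have [_ +] := LS Y LY F (conj sF F0); apply.
Qed.

(** A linear form that vanishes on a proper [M] but not on some [x] is killed at
    the points of [G * M] by all the fields of the algebra, but not by the constant
    vertical field of direction [x]. *)
Lemma spans_nondegenerate :
  (forall p (v : (G * g -> R) -> R), tangent_vector (phase_atlas G e) p v ->
    exists2 Y, L Y & forall F, smoothP F -> v F = Y F p) ->
  forall M : {vspace g}, (forall j, col_vec j \in M) ->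
     (forall z z', z \in M -> z' \in M -> Q z z' \in M) -> M = fullv.
Proof.
move=> span M sM QM; apply/eqP; rewrite eqEsubv subvf /=.
apply/subvP => x _; apply/negPn/negP => xM.
pose pi (z : g) := z - projv M z.
have pi0 z : z \in M -> pi z = 0 by move=> zM; rewrite /pi projv_id ?subrr.
have pix : pi x != 0.
  apply: contra xM; rewrite /pi subr_eq0 => /eqP ->; exact: memv_proj.
have [k pik] : exists k : 'I_n, coord e k (pi x) != 0.
  apply/existsP; apply: contraNT pix; rewrite negb_exists => /forallP H.
  apply/eqP; rewrite (coord_basis basis_e (memvf (pi x))) big1// => k _.
  by have := H k; rewrite negbK => /eqP ->; rewrite scale0r.
(* the linear form: a coordinate of the projection along [M] *)
pose phi z := coord e k (pi z).
have lphi a u v : phi (a *: u + v) = a * phi u + phi v.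
  by rewrite /phi /pi linearP opprD addrACA -scalerBr linearP.
pose F (p : G * g) := phi p.2.
have sF : smoothP F by exact: (smooth_phase_scalar basis_e).
pose p0 : G * g := (1%g, 0).
have [c Ac c1] := atlas_cover (1%g : G).
have [|Y LY YE] := span p0 (fun F => fiber_field x F p0).
  exists (pchart c), (row_mx 0 (cvec x)); split=> [||f sf].
  - by exists c, (coord_chart e).
  - by split.
  - rewrite -(fiber_fieldE basis_e) /=; congr fiber_field.
    by rewrite -[LHS](phase_inv_map basis_e Ac).
have F0 p : p.2 \in M -> F p = 0 by move=> pM; rewrite /F /phi (pi0 _ pM) linear0.
have fx : fiber_field x F p0 = phi x.
  apply: fiber_val.
  rewrite (_ : (fun s => _) = fun s : R => 0 + s * phi x + s ^+ 2 * 0).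
    exact: is_derive_quadratic.
  apply/funext => t.
  rewrite /F /= add0r mulr0 addr0 add0r -[t *: x]addr0 lphi.
  by rewrite {2}/phi (pi0 _ (mem0v M)) linear0 addr0.
move: pik; rewrite -[coord e k (pi x)]/(phi x) -fx (YE F sF).
by rewrite (hormander_tangent sM QM LY sF F0 (mem0v M : p0.2 \in M)) eqxx.
Qed.

End bracket_condition.

Theorem theorem3p1 (R : realType) (n : nat) (G : lieGroupType R n)
    (g : vectType R) (lv : g -> operator R G) (br : g -> g -> g)
    (hg : is_lie_algebra_of lv br)
    (ip : {dot g for idfun})
    (e : n.-tuple g) (he : orthonormal_basis ip e)
    (qt : {bilinear g -> g -> g})
    (hqt : forall x y z : g, ip (br x y) z = ip (qt z x) y)
    (nu eps : R) (hnu : 0 < nu) (heps : 0 < eps)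
    (h : 'M[R]_n) (hh : symmetric_psd h)
    (r : nat) (sigma : 'M[R]_(n, r)) (hsigma : h = sigma *m sigma^T) :
  let q := sym_form qt in
  hormander_condition (phase_atlas G e)
    (fokker_planck lv e q nu eps h)
    (drift_field lv e q nu)
    (diffusion_field G e sigma)
  <-> nondegenerate_wrt q (range (mx_endo e h)).
Proof.
move=> q.
have [left_lv linear_lv inj_lv _ _] := hg.
have [basis_e _] := he.
have QC x y : q x y = q y x by rewrite /q /sym_form addrC.
have QL a x y z : q (a *: x + y) z = a *: q x z + q y z.
  rewrite /q /sym_form linearPl linearPr addrACA -scalerDr [LHS]scalerDr.
  by rewrite !scalerA [a * _]mulrC.
pose col_vec j := \sum_k sigma k j *: e`_k.
(* By [range_gram], the columns of [sigma] span the range of [h]. *)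
have rangeP (M : {vspace g}) :
    (forall z, range (mx_endo e h) z -> z \in M) <-> (forall j, col_vec j \in M).
  have coordE (t : 'I_n -> R) k : coord e k (\sum_l t l *: e`_l) = t k.
    by rewrite coord_sum_free// (basis_free basis_e).
  split=> [rM j|cM _ [z _ <-]].
    have [D sD] := range_gram sigma.
    apply: rM; exists (\sum_l D l j *: e`_l) => //.
    apply: eq_bigr => k _; congr (_ *: _).
    rewrite [in RHS]sD -hsigma mxE; apply: eq_bigr => l _.
    by rewrite coordE.
  have -> : mx_endo e h z = \sum_j (\sum_l sigma l j * coord e l z) *: col_vec j.
    under [RHS]eq_bigr => j _ do rewrite scaler_sumr.
    rewrite exchange_big /=; apply: eq_bigr => k _.
    under [RHS]eq_bigr => j _ do rewrite scalerA.
    rewrite -scaler_suml; congr (_ *: _).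
    under [RHS]eq_bigr => j _ do rewrite mulr_suml.
    rewrite exchange_big /=; apply: eq_bigr => l _.
    rewrite hsigma mxE mulr_suml; apply: eq_bigr => j _.
    by rewrite mxE -mulrA mulrC.
  by apply: memv_suml => j _; apply: memvZ.
split=> [[_ span] [M [Mfull rM QM]]|nondeg].
  move/eqP: Mfull; apply.
  apply: (spans_nondegenerate basis_e left_lv QC QL span) => //.
  exact/rangeP.
split; first exact: sum_of_squares.
apply: (nondegenerate_spans nu basis_e left_lv linear_lv inj_lv QC QL) => M cM QM.
apply/eqP/negPn/negP => Mfull; apply: nondeg; exists M; split=> //.
exact/rangeP.
Qed.
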